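(* (a) Let $f_{11},f_{12}=f_{21},f_{22}$ be $C^\infty$ functions on $J^1(\mathbb R^2,\mathbb R)$ satisfying the integrability condition $A=B=0$. Then the fifteen curvatures $M_1,M_3,M_5,M_6,M_7,M_8,S_1,S_2,S_5,S_6,S_8,S_9,S_{11},S_{12},S_{14}$ of the PDE $y_{x_ix_j}=f_{ij}(x_1,x_2,y,z_1,z_2)$ for the equivalence problem under lifts of scale transformations (the coefficients in the structure equations recalled in the context) are given explicitly by $$M_1=-\tfrac{c}{gh}(f_{11})_{z_2},\quad M_3=-\tfrac{1}{gh}(f_{12})_{z_2z_2},\quad M_5=\tfrac{1}{hk}\{(f_{12})_y+(f_{12})_{z_1}(f_{12})_{z_2}-D_2((f_{12})_{z_2})\},$$ $$M_6=-\tfrac{g}{ck}(f_{22})_{z_1},\quad M_7=-\tfrac{1}{ck}(f_{12})_{z_1z_1},\quad M_8=\tfrac{1}{hk}\{(f_{12})_y+(f_{12})_{z_1}(f_{12})_{z_2}-D_1((f_{12})_{z_1})\},$$ $$S_1=\tfrac{1}{ch^2}\{D_2((f_{11})_{z_1z_2})+(f_{11})_{z_2z_2}(f_{22})_{z_1}+(f_{11})_{z_1z_2}(f_{22})_{z_2}-(f_{12})_{z_1z_2}(f_{11})_{z_2}-(f_{12})_{z_2z_2}(f_{12})_{z_2}-(f_{12})_{z_1z_2}(f_{11})_{z_1}+2(f_{12})_{z_1z_2}(f_{12})_{z_2}\},$$ $$S_2=\tfrac{1}{chk}\{D_2((f_{12})_{z_1z_2})-(f_{12})_{z_1y}-(f_{12})_{z_1z_1}(f_{12})_{z_2}\},\quad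 S_5=\tfrac{1}{ch}\{2(f_{12})_{z_1z_2}-(f_{11})_{z_1z_1}\},$$ $$S_6=\tfrac{1}{hk}\{-(f_{12})_y-(f_{12})_{z_1}(f_{12})_{z_2}+(f_{11})_{z_2}(f_{22})_{z_1}+D_2((f_{12})_{z_2})\},\quad S_8=\tfrac{1}{hk}\{D_2((f_{11})_{z_1})-2D_2((f_{12})_{z_2})\},$$ $$S_9=\tfrac{1}{ch^2}\{(f_{11})_{z_1y}-2(f_{12})_{z_2y}+(f_{11})_{z_1z_1}(f_{12})_{z_2}+(f_{11})_{z_1z_2}(f_{12})_{z_1}-2(f_{12})_{z_1z_2}(f_{12})_{z_2}-2(f_{12})_{z_2z_2}(f_{12})_{z_1}\},$$ $$S_{11}=\tfrac{1}{hk}\{2D_1((f_{12})_{z_1})-D_1((f_{22})_{z_2})\},\quad S_{14}=\tfrac{1}{gk}\{2(f_{12})_{z_1z_2}-(f_{22})_{z_2z_2}\},$$ $$S_{12}=\tfrac{1}{chk}\{-2(f_{12})_{z_1y}-2(f_{12})_{z_1z_1}(f_{12})_{z_2}-2(f_{12})_{z_1z_2}(f_{12})_{z_1}+(f_{22})_{z_2y}+(f_{22})_{z_1z_2}(f_{12})_{z_2}+(f_{22})_{z_2z_2}(f_{12})_{z_1}\}.$$ (b) In particular, suppose that $f_{11}=P(x_1,x_2,y)$, $f_{12}=f_{21}=Q(x_1,x_2,y)$, $f_{22}=R(x_1,x_2,y)$ with $P,Q,R$ of class $C^\infty$. Then the PDE $y_{x_ix_j}=f_{ij}$ is locally equivalent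 to the flat equation under lifts of scale transformations if and only if it is integrable, i.e. $A=B=0$.
   Context: Setting. $J^1=J^1(\mathbb R^2,\mathbb R)$ has coordinates $(x_1,x_2,y,z_1,z_2)$. For $C^\infty$ functions $f_{ij}$ on $J^1$ ($1\le i,j\le 2$, $f_{12}=f_{21}$) consider the PDE system $\frac{\partial^2y}{\partial x_i\partial x_j}=f_{ij}(x_1,x_2,y,z_1,z_2)$, $z_i=y_{x_i}$, for $y=y(x_1,x_2)$; it is called flat if all $f_{ij}=0$. Subscripts $y,z_1,z_2$ denote partial derivatives, and $$D_1=\partial_{x_1}+z_1\partial_y+f_{11}\partial_{z_1}+f_{12}\partial_{z_2},\qquad D_2=\partial_{x_2}+z_2\partial_y+f_{12}\partial_{z_1}+f_{22}\partial_{z_2}.$$ The equation is integrable if $A=B=0$ identically, where $A=D_2(f_{11})-D_1(f_{12})$, $B=D_2(f_{12})-D_1(f_{22})$. Coframe on $J^1$: $\underline\theta_0=dy-z_1dx_1-z_2dx_2$, $\underline\theta_1=dz_1-f_{11}dx_1-f_{12}dx_2$, $\underline\theta_2=dz_2-f_{12}dx_1-f_{22}dx_2$, $\underline\omega_1=dx_1$, $\underline\omega_2=dx_2$. Scale transformations: a (local) diffeomorphism of $\mathbb R^3$ of the form $\phi(x_1,x_2,y)=(X_1(x_1),X_2(x_2),Y(x_1,x_2,y))$; its lift to $J^1$ is $\hat\phi=(X_1,X_2,Y,Z_1,Z_2)$ with $Z_i=(Y_{x_i}+Y_yz_i)/(X_i)_{x_i}$. ''Locally equivalent to the flat equation under lifts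 of scale transformations'' means: every point of $J^1$ has a neighbourhood on which the lift $\hat\phi$ of some local scale transformation is defined and carries the PDE to the flat one, i.e. the $1$-forms $\hat\phi^*(dy-z_1dx_1-z_2dx_2),\hat\phi^*dz_1,\hat\phi^*dz_2$ span the same module as $\underline\theta_0,\underline\theta_1,\underline\theta_2$. Curvatures. Let $\mathcal F_{G_1}=J^1\times\{(c,g,h,k)\in(\mathbb R\setminus\{0\})^4: ch=gk\}$, and on it $\hat\theta_0=ch\,\underline\theta_0$, $\hat\theta_1=c(\underline\theta_1-(f_{12})_{z_2}\underline\theta_0)$, $\hat\theta_2=g(\underline\theta_2-(f_{12})_{z_1}\underline\theta_0)$, $\hat\omega_1=h\underline\omega_1$, $\hat\omega_2=k\underline\omega_2$, $\hat\alpha=\frac{dc}{c}+(f_{12})_{z_1z_2}\underline\theta_0+((f_{11})_{z_1}-(f_{12})_{z_2})\underline\omega_1+(f_{12})_{z_1}\underline\omega_2$, $\hat\gamma=\frac{dh}{h}+(2(f_{12})_{z_2}-(f_{11})_{z_1})\underline\omega_1$, $\hat\psi=\frac{dk}{k}+(2(f_{12})_{z_1}-(f_{22})_{z_2})\underline\omega_2$. These eight forms $\hat\theta_0,\hat\theta_1,\hat\theta_2,\hat\omega_1,\hat\omega_2,\hat\alpha,\hat\gamma,\hat\psi$ are a coframe of $\mathcal F_{G_1}$, and when $A=B=0$ the functions $M_i,S_j$ are the coefficients in the structure equations $d\hat\theta_0=(\hat\alpha+\hat\gamma)\wedge\hat\theta_0+\hat\omega_1\wedge\hat\theta_1+\hat\omega_2\wedge\hat\theta_2$,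 $d\hat\theta_1=\hat\alpha\wedge\hat\theta_1+M_1\hat\theta_2\wedge\hat\omega_1+M_3\hat\theta_2\wedge\hat\theta_0+M_4\hat\omega_1\wedge\hat\theta_0+M_5\hat\omega_2\wedge\hat\theta_0$, $d\hat\theta_2=(\hat\alpha+\hat\gamma-\hat\psi)\wedge\hat\theta_2+M_6\hat\theta_1\wedge\hat\omega_2+M_7\hat\theta_1\wedge\hat\theta_0+M_8\hat\omega_1\wedge\hat\theta_0+M_9\hat\omega_2\wedge\hat\theta_0$, $d\hat\omega_1=\hat\gamma\wedge\hat\omega_1$, $d\hat\omega_2=\hat\psi\wedge\hat\omega_2$, $d\hat\alpha=S_1\hat\omega_1\wedge\hat\theta_0+S_2\hat\omega_2\wedge\hat\theta_0+S_3\hat\theta_1\wedge\hat\theta_0+S_4\hat\theta_2\wedge\hat\theta_0+S_5\hat\omega_1\wedge\hat\theta_1+S_6\hat\omega_1\wedge\hat\omega_2+S_7\hat\theta_2\wedge\hat\omega_1-M_7\hat\theta_1\wedge\hat\omega_2$, $d\hat\gamma=S_8\hat\omega_1\wedge\hat\omega_2+S_9\hat\omega_1\wedge\hat\theta_0+S_5\hat\theta_1\wedge\hat\omega_1+S_{10}\hat\theta_2\wedge\hat\omega_1$, $d\hat\psi=S_{11}\hat\omega_1\wedge\hat\omega_2+S_{12}\hat\omega_2\wedge\hat\theta_0+S_{13}\hat\theta_1\wedge\hat\omega_2+S_{14}\hat\theta_2\wedge\hat\omega_2$.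
   Formalization: The printed S_1 is false (f11=z1²+z2, f12=z1z2, f22=z2²: true S_1=0, printed −1/(ch²)); after its first three terms, the rest of the bracket is replaced by (f22)_{z1z2}(f11)_{z2} − (f12)_{z1z1}(f11)_{z2} − (f11)_{z1z2}(f12)_{z1}. *)

(* Defs.v *)
From HB Require Import structures.
From mathcomp Require Import all_boot all_order all_algebra.
From mathcomp Require Import all_classical all_reals all_analysis.

Set Implicit Arguments.
Unset Strict Implicit.
Unset Printing Implicit Defensive.

Import Order.TTheory GRing.Theory Num.Theory.
Import numFieldNormedType.Exports.
Local Open Scope classical_set_scope.
Local Open Scope ring_scope.

Section Smooth.
Context {R : realType} {n : nat}.
Implicit Types (U V : set 'rV[R]_n) (f : 'rV[R]_n -> R).

Definition partial (i : 'I_n) f (p : 'rV[R]_n) : R :=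
  'D_(delta_mx ord0 i) f p.

(* C^oo on U: every iterated partial derivative is Frechet-differentiable at
   every point of U.  For open U this only depends on f restricted to U. *)
Definition smooth U f :=
  forall s : seq 'I_n, forall p, U p -> differentiable (foldr partial f s) p.

Definition smooth_map U (phi : 'rV[R]_n -> 'rV[R]_n) :=
  forall i, smooth U (fun p => phi p ord0 i).

Definition diffeo U V (phi : 'rV[R]_n -> 'rV[R]_n) :=
  [/\ open U, open V, smooth_map U phi, (forall p, U p -> V (phi p)) &
   exists psi : 'rV[R]_n -> 'rV[R]_n,
     [/\ smooth_map V psi, (forall q, V q -> U (psi q)),
         (forall p, U p -> psi (phi p) = p) &
         (forall q, V q -> phi (psi q) = q)]].

End Smooth.

Section Forms.
Context {R : realType}.

(* A form is a function of the base point and of tangent vectors, added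
   pointwise; all the forms used below are linear and smooth where they are
   evaluated. *)
Definition form1 (V : normedModType R) : Type := V -> V -> R.
Definition form2 (V : normedModType R) : Type := V -> V -> V -> R.

Definition fscale {V : normedModType R} {T : lmodType R} (m : V -> R)
  (a : V -> T) : V -> T := fun p => m p *: a p.

Definition wedge {V : normedModType R} (a b : form1 V) : form2 V :=
  fun p u v => a p u * b p v - a p v * b p u.

Definition dfun {V : normedModType R} (f : V -> R) : form1 V :=
  fun p v => 'd f p v.

(* Cartan's formula for the constant vector fields u and v, whose bracket
   vanishes. *)
Definition dform {V : normedModType R} (w : form1 V) : form2 V :=
  fun p u v => 'd (fun q => w q v) p u - 'd (fun q => w q u) p v.

Definition pullback {V W : normedModType R} (Phi : V -> W) (w : form1 W) :
    form1 V :=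
  fun p v => w (Phi p) ('d Phi p v).

End Forms.

Notation "m \*f a" := (fscale m a) (at level 41, right associativity).
Notation "a \wedge b" := (wedge a b) (at level 40, no associativity).

Section JetSpace.
Context {R : realType}.

(* J^1(R^2, R), with coordinates (x1, x2, y, z1, z2). *)
Notation J1 := 'rV[R]_5.
(* R^3, with coordinates (x1, x2, y). *)
Notation J0 := 'rV[R]_3.

Definition ix1 : 'I_5 := @Ordinal 5 0 isT.
Definition ix2 : 'I_5 := @Ordinal 5 1 isT.
Definition iy  : 'I_5 := @Ordinal 5 2 isT.
Definition iz1 : 'I_5 := @Ordinal 5 3 isT.
Definition iz2 : 'I_5 := @Ordinal 5 4 isT.

Definition x1 (p : J1) : R := p ord0 ix1.
Definition x2 (p : J1) : R := p ord0 ix2.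
Definition y  (p : J1) : R := p ord0 iy.
Definition z1 (p : J1) : R := p ord0 iz1.
Definition z2 (p : J1) : R := p ord0 iz2.

Definition pd_x1 : (J1 -> R) -> J1 -> R := partial ix1.
Definition pd_x2 : (J1 -> R) -> J1 -> R := partial ix2.
Definition pd_y  : (J1 -> R) -> J1 -> R := partial iy.
Definition pd_z1 : (J1 -> R) -> J1 -> R := partial iz1.
Definition pd_z2 : (J1 -> R) -> J1 -> R := partial iz2.

Definition jx1 : 'I_3 := @Ordinal 3 0 isT.
Definition jx2 : 'I_3 := @Ordinal 3 1 isT.
Definition jy  : 'I_3 := @Ordinal 3 2 isT.

Definition J0_of_J1 (p : J1) : J0 := \row_(i < 3) [:: x1 p; x2 p; y p]`_i.

(* The system y_{x_i x_j} = f_ij; rhs12 also plays the role of f21. *)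
Record pde := Pde { rhs11 : J1 -> R; rhs12 : J1 -> R; rhs22 : J1 -> R }.

Definition smooth_pde (E : pde) :=
  [/\ smooth [set: J1] (rhs11 E), smooth [set: J1] (rhs12 E)
    & smooth [set: J1] (rhs22 E)].

Definition D1 (E : pde) (F : J1 -> R) (p : J1) : R :=
  pd_x1 F p + z1 p * pd_y F p + rhs11 E p * pd_z1 F p + rhs12 E p * pd_z2 F p.
Definition D2 (E : pde) (F : J1 -> R) (p : J1) : R :=
  pd_x2 F p + z2 p * pd_y F p + rhs12 E p * pd_z1 F p + rhs22 E p * pd_z2 F p.

Definition obstrA (E : pde) (p : J1) : R := D2 E (rhs11 E) p - D1 E (rhs12 E) p.
Definition obstrB (E : pde) (p : J1) : R := D2 E (rhs12 E) p - D1 E (rhs22 E) p.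

Definition integrable_pde (E : pde) :=
  forall p, obstrA E p = 0 /\ obstrB E p = 0.

Definition omega1 : form1 J1 := dfun x1.
Definition omega2 : form1 J1 := dfun x2.
Definition theta0 : form1 J1 :=
  (dfun y - z1 \*f dfun x1 - z2 \*f dfun x2).
Definition theta1 (E : pde) : form1 J1 :=
  (dfun z1 - rhs11 E \*f dfun x1 - rhs12 E \*f dfun x2).
Definition theta2 (E : pde) : form1 J1 :=
  (dfun z2 - rhs12 E \*f dfun x1 - rhs22 E \*f dfun x2).

Definition scale_map (X1 X2 : R -> R) (Y : J0 -> R) (q : J0) : J0 :=
  \row_(i < 3) [:: X1 (q ord0 jx1); X2 (q ord0 jx2); Y q]`_i.

Definition is_scale_transformation (U : set J0) (X1 X2 : R -> R) (Y : J0 -> R) :=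
  exists V : set J0, diffeo U V (scale_map X1 X2 Y).

(* The divisors do not vanish over the domain of a scale transformation. *)
Definition scale_lift (X1 X2 : R -> R) (Y : J0 -> R) (p : J1) : J1 :=
  let q := J0_of_J1 p in
  \row_(i < 5)
    [:: X1 (x1 p); X2 (x2 p); Y q;
        (partial jx1 Y q + partial jy Y q * z1 p) / derive1 X1 (x1 p);
        (partial jx2 Y q + partial jy Y q * z2 p) / derive1 X2 (x2 p)]`_i.

(* The C^oo(N)-module of 1-forms on N spanned by a, b and c; its elements are
   represented by forms on J1 of which only the restriction to N matters. *)
Definition span_on (N : set J1) (a b c : form1 J1) : set (form1 J1) :=
  [set w | exists k0 k1 k2 : J1 -> R,
     [/\ smooth N k0, smooth N k1, smooth N k2 &
      forall p, N p -> forall v,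
        w p v = k0 p * a p v + k1 p * b p v + k2 p * c p v]].

Definition locally_flat_under_scale (E : pde) :=
  forall p : J1, exists N : set J1, [/\ open N, N p &
    exists (U : set J0) (X1 X2 : R -> R) (Y : J0 -> R),
      [/\ is_scale_transformation U X1 X2 Y,
          (forall q, N q -> U (J0_of_J1 q)) &
          let Phi := scale_lift X1 X2 Y in
          span_on N (pullback Phi theta0) (pullback Phi (dfun z1))
                    (pullback Phi (dfun z2))
          = span_on N theta0 (theta1 E) (theta2 E)]].

(* F_{G_1} is the hypersurface ch = gk of the open subset cghk <> 0 of
   J^1 x R^4.  Forms on it are restrictions of forms on J^1 x R^4, and are
   compared on its tangent vectors. *)
Notation Amb := ('rV[R]_5 * 'rV[R]_4)%type.

Definition cc (e : Amb) : R := e.2 ord0 (@Ordinal 4 0 isT).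
Definition cg (e : Amb) : R := e.2 ord0 (@Ordinal 4 1 isT).
Definition ch (e : Amb) : R := e.2 ord0 (@Ordinal 4 2 isT).
Definition ck (e : Amb) : R := e.2 ord0 (@Ordinal 4 3 isT).

Definition FG1 : set Amb :=
  [set e | [/\ cc e != 0, cg e != 0, ch e != 0, ck e != 0
             & cc e * ch e = cg e * ck e]].

Definition tangent_FG1 (e v : Amb) :=
  'd (fun e' : Amb => cc e' * ch e' - cg e' * ck e') e v = 0.

Definition eq_on_FG1 (a b : form2 Amb) :=
  forall e, FG1 e -> forall u v, tangent_FG1 e u -> tangent_FG1 e v ->
    a e u v = b e u v.

Definition up_fun (F : J1 -> R) (e : Amb) : R := F e.1.
Definition up (w : form1 J1) : form1 Amb := pullback fst w.

Definition htheta0 : form1 Amb :=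
  ((fun e => cc e * ch e) \*f up theta0).
Definition htheta1 (E : pde) : form1 Amb :=
  (cc \*f up (theta1 E - pd_z2 (rhs12 E) \*f theta0)).
Definition htheta2 (E : pde) : form1 Amb :=
  (cg \*f up (theta2 E - pd_z1 (rhs12 E) \*f theta0)).
Definition homega1 : form1 Amb := (ch \*f up omega1).
Definition homega2 : form1 Amb := (ck \*f up omega2).

Definition dlog (m : Amb -> R) : form1 Amb := ((fun e => (m e)^-1) \*f dfun m).

Definition halpha (E : pde) : form1 Amb :=
  (dlog cc + up (pd_z2 (pd_z1 (rhs12 E)) \*f theta0
                 + (fun p => pd_z1 (rhs11 E) p - pd_z2 (rhs12 E) p) \*f omega1
                 + pd_z1 (rhs12 E) \*f omega2)).
Definition hgamma (E : pde) : form1 Amb :=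
  (dlog ch + up ((fun p => 2 * pd_z2 (rhs12 E) p - pd_z1 (rhs11 E) p) \*f omega1)).
Definition hpsi (E : pde) : form1 Amb :=
  (dlog ck + up ((fun p => 2 * pd_z1 (rhs12 E) p - pd_z2 (rhs22 E) p) \*f omega2)).

(* The forms of the structure equations are a coframe of F_{G_1}, so these
   equations determine the coefficients.  M i and S j stand for the curvatures M_i and S_j; the values of M and S at
   other indices are irrelevant. *)
Definition structure_equations (E : pde) (M S : nat -> Amb -> R) :=
  let t0 := htheta0 in let t1 := htheta1 E in let t2 := htheta2 E in
  let w1 := homega1 in let w2 := homega2 in
  let al := halpha E in let ga := hgamma E in let ps := hpsi E in
  [/\ eq_on_FG1 (dform t0)
        ((al + ga) \wedge t0 + w1 \wedge t1 + w2 \wedge t2),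
      eq_on_FG1 (dform t1)
        (al \wedge t1 + M 1%N \*f t2 \wedge w1 + M 3%N \*f t2 \wedge t0
         + M 4%N \*f w1 \wedge t0 + M 5%N \*f w2 \wedge t0),
      eq_on_FG1 (dform t2)
        ((al + ga - ps) \wedge t2 + M 6%N \*f t1 \wedge w2 + M 7%N \*f t1 \wedge t0
         + M 8%N \*f w1 \wedge t0 + M 9%N \*f w2 \wedge t0),
      eq_on_FG1 (dform w1) (ga \wedge w1) /\
      eq_on_FG1 (dform w2) (ps \wedge w2) &
    [/\ eq_on_FG1 (dform al)
        (S 1%N \*f w1 \wedge t0 + S 2%N \*f w2 \wedge t0 + S 3%N \*f t1 \wedge t0
         + S 4%N \*f t2 \wedge t0 + S 5%N \*f w1 \wedge t1 + S 6%N \*f w1 \wedge w2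
         + S 7%N \*f t2 \wedge w1 - M 7%N \*f t1 \wedge w2),
      eq_on_FG1 (dform ga)
        (S 8%N \*f w1 \wedge w2 + S 9%N \*f w1 \wedge t0 + S 5%N \*f t1 \wedge w1
         + S 10%N \*f t2 \wedge w1) &
      eq_on_FG1 (dform ps)
        (S 11%N \*f w1 \wedge w2 + S 12%N \*f w2 \wedge t0 + S 13%N \*f t1 \wedge w2
         + S 14%N \*f t2 \wedge w2)]].

End JetSpace.

(* Main.v *)
(* Part (a): each structure equation is an identity between 2-forms.  Expanding
   dF = D1F w1 + D2F w2 + F_y th0 + F_z1 th1 + F_z2 th2 turns both sides into
   polynomials in the values of the coframe, and the identities that remain
   follow from A = 0, B = 0 and the z-derivatives of A = 0.  Evaluating the
   equations on vectors dual to the coframe shows that the coefficients are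
   unique.

   Part (b): if the lift of a scale transformation flattens the equation, then
   dZ_i lies in the span of th0, th1, th2, so D1 and D2 annihilate Z_i, and so
   does their bracket - A d/dz1 - B d/dz2; as (Z_i)_{z_j} = 0 for i <> j and
   (Z_i)_{z_i} = Y_y / X_i' <> 0, this gives A = B = 0.  Conversely, A = B = 0
   is affine in z1, z2 when P, Q, R do not involve them; it says that P, Q, R
   do not depend on y and are the second derivatives of a function u(x1, x2),
   and Y = y - u, X_i = x_i flattens the equation. *)

Require Import Defs.
From HB Require Import structures.
From mathcomp Require Import all_boot all_order all_algebra.
From mathcomp Require Import all_classical all_reals all_analysis.
From mathcomp Require Import ring lra.

Set Implicit Arguments.
Unset Strict Implicit.
Unset Printing Implicit Defensive.

Import Order.TTheory GRing.Theory Num.Theory.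
Import numFieldNormedType.Exports.
Local Open Scope classical_set_scope.
Local Open Scope ring_scope.

(** * Mean value theorem and symmetry of second derivatives *)

Section Calculus.
Context {R : realType}.

(** Two classical facts carry the analysis: symmetry of second derivatives, which cancels the
    second-order terms of the bracket and lets z-derivatives pass through [D1] and [D2], and the
    Poincare lemma, which builds u.

    From flatness to integrability the obstacle is locality and regularity: dZ_i is described only
    on a neighbourhood [N], while the bracket needs second derivatives of Z_i. They come from the
    coefficients of dZ_i in the span, since near the point the first partials of Z_i are polynomials
    in these coefficients, the f_ij and z1, z2.

    In part (a) the relation ch = gk serves to eliminate g and dg: the fibre part of alpha + gamma -
    psi is dc/c + dh/h - dk/k, which is dg/g on tangent vectors of F_G1. A = 0 and B = 0 remove the
    omega1, omega2 terms of d theta1 and d theta2; the derivatives of A = 0 by z1 and by z1, z2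
    enter d alpha alone, where they eliminate D1 of (f12)_{z1} and of (f12)_{z1z2}. *)

Lemma is_derive_line (V W : normedModType R) (f : V -> W) a v s :
  derivable f (a + s *: v) v ->
  is_derive s 1 (fun t => f (a + t *: v)) ('D_v f (a + s *: v)).
Proof.
move=> df.
have e : (fun h => h^-1 *: (((fun t => f (a + t *: v)) \o shift s) (h *: 1)
            - f (a + s *: v))) =
         (fun h => h^-1 *: ((f \o shift (a + s *: v)) (h *: v)
            - f (a + s *: v))).
  apply/funext => h /=; congr (_ *: (f _ - _)).
  by rewrite scalerDl -scalerA scale1r addrCA.
by apply: DeriveDef; rewrite /derivable /derive e.
Qed.

Lemma line_mean_value (V : normedModType R) (f : V -> R) (a v : V) :
  (forall t : R, 0 <= t <= 1 -> derivable f (a + t *: v) v) ->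
  exists2 t : R, 0 <= t <= 1 & f (a + v) - f a = 'D_v f (a + t *: v).
Proof.
move=> df; pose g (t : R) := f (a + t *: v).
have dg (t : R) : 0 <= t <= 1 -> is_derive t 1 g ('D_v f (a + t *: v)).
  by move=> /df; exact: is_derive_line.
have [||t] := @MVT_segment _ g (fun t => 'D_v f (a + t *: v)) 0 1 ler01.
- by move=> t; rewrite in_itv/= => /andP[/ltW ? /ltW ?]; apply: dg; apply/andP.
- apply: derivable_within_continuous => t; rewrite in_itv/= => /dg.
  by case.
rewrite in_itv/= => t01; rewrite /g scale1r scale0r addr0 subr0 mulr1 => e.
by exists t.
Qed.

Lemma differentiable_remainder (V : normedModType R) (g : V -> R) (p : V)
    (e : R) :
  0 < e -> differentiable g p ->
  \forall h \near (0 : V), `|g (p + h) - g p - 'd g p h| <= e * `|h|.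
Proof.
move=> e0 dg.
have /eqaddoP/(_ e e0) := diff_locally dg.
by apply: filterS => h /=; rewrite /shift/= !fctE/= opprD addrA [h + p]addrC.
Qed.

(** Young's argument: the mean value theorem along u, applied to f(q + tv) - f(q), turns the second
    difference into t times an increment of ['D_u f], and the first-order expansion of ['D_u f] at
    the single point p evaluates that increment. *)
Lemma second_difference (V : normedModType R) (f : V -> R) (p u v : V) (e : R) :
  0 < e -> (\forall q \near p, differentiable f q) ->
  differentiable ('D_u f) p ->
  \forall t \near (0 : R),
    `|f (p + t *: u + t *: v) - f (p + t *: u) - f (p + t *: v) + f p
       - t ^+ 2 * 'D_v ('D_u f) p| <= e * t ^+ 2.
Proof.
(* Two remainders, each at most e / K times |t| (|u| + |v|), have to add up to at most e |t|, hence
   the factor 2. The summand 1 keeps [K] positive when u = v = 0. *)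
move=> e0 df dfu; set K := 2 * (`|u| + `|v|) + 1.
have K0 : 0 < K by rewrite /K; have := normr_ge0 u; have := normr_ge0 v; lra.
have /nbhs_ballP[r /= r0 rP] := differentiable_remainder (divr_gt0 e0 K0) dfu.
have /nbhs_ballP[r' /= r'0 r'P] := df.
apply/nbhs_ballP; exists (Num.min r r' / K) => /=.
  by rewrite divr_gt0// lt_min r0.
move=> t; rewrite /ball/= sub0r normrN ltr_pdivlMr// lt_min => /andP[tr tr'].
have le_bound (a b : R) : 0 <= a <= 1 -> 0 <= b <= 1 ->
    `|(a * t) *: u + (b * t) *: v| <= `|t| * (`|u| + `|v|).
  move=> /andP[a0 a1] /andP[b0 b1]; rewrite (le_trans (ler_normD _ _))//.
  rewrite !normrZ (ger0_norm a0) (ger0_norm b0) mulrDr.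
  by rewrite lerD// ler_wpM2r// ler_piMl.
have lt_K : `|t| * (`|u| + `|v|) <= `|t| * K.
  by rewrite ler_wpM2l// /K; have := normr_ge0 u; have := normr_ge0 v; lra.
have dif (a b : R) : 0 <= a <= 1 -> 0 <= b <= 1 ->
    differentiable f (p + ((a * t) *: u + (b * t) *: v)).
  move=> a01 b01; apply: r'P; rewrite -ball_normE /= opprD addNKr normrN.
  exact: le_lt_trans (le_trans (le_bound _ _ a01 b01) lt_K) tr'.
have rem (a b : R) : 0 <= a <= 1 -> 0 <= b <= 1 ->
    `|'D_u f (p + ((a * t) *: u + (b * t) *: v)) - 'D_u f p
      - 'd ('D_u f) p ((a * t) *: u + (b * t) *: v)| <=
    e / K * (`|t| * (`|u| + `|v|)).
  move=> a01 b01; apply: le_trans (rP _ _) _.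
    rewrite -ball_normE /= sub0r normrN.
    exact: le_lt_trans (le_trans (le_bound _ _ a01 b01) lt_K) tr.
  by rewrite ler_wpM2l ?le_bound// divr_ge0// ltW.
have i0 : 0 <= (0 : R) <= 1 by rewrite lexx ler01.
have i1 : 0 <= (1 : R) <= 1 by rewrite lexx ler01.
pose phi := (f \o shift (t *: v)) - f.
have derf (s b : R) : 0 <= s <= 1 -> 0 <= b <= 1 ->
    derivable f (p + ((s * t) *: u + (b * t) *: v)) (t *: u).
  by move=> s01 b01; apply: diff_derivable; exact: dif.
have derphi (s : R) : 0 <= s <= 1 ->
   is_derive (p + s *: (t *: u)) (t *: u) phi
     (t * 'D_u f (p + ((s * t) *: u + (1 * t) *: v))
      - t * 'D_u f (p + ((s * t) *: u + (0 * t) *: v))).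
  move=> s01; apply: is_deriveB; last first.
    have := derf s 0 s01 i0; rewrite mul0r scale0r addr0 scalerA => d.
    apply: DeriveDef => //; rewrite deriveE; last first.
      by have := dif s 0 s01 i0; rewrite mul0r scale0r addr0.
    rewrite linearZ deriveE//.
    by have := dif s 0 s01 i0; rewrite mul0r scale0r addr0.
  have := dif s 1 s01 i1; rewrite mul1r addrA -scalerA => d.
  have dd : is_derive (p + s *: (t *: u)) (t *: u) (f \o shift (t *: v))
      ('D_(t *: u) f (p + s *: (t *: u) + t *: v)).
    have e1 : (fun h => h^-1 *: (((f \o shift (t *: v)) \o shift (p + s *: (t *: u)))
              (h *: (t *: u)) - (f \o shift (t *: v)) (p + s *: (t *: u)))) =
         (fun h => h^-1 *: ((f \o shift (p + s *: (t *: u) + t *: v)) (h *: (t *: u))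
            - f (p + s *: (t *: u) + t *: v))).
      by apply/funext => h /=; rewrite !addrA.
    apply: DeriveDef; rewrite /derivable /derive e1 //.
    exact: diff_derivable.
  apply: is_derive_eq dd _.
  by rewrite deriveE// linearZ deriveE.
have [|s s01] := @line_mean_value _ phi p (t *: u).
  by move=> s /derphi[].
move=> E.
have -> : f (p + t *: u + t *: v) - f (p + t *: u) - f (p + t *: v) + f p
  = phi (p + t *: u) - phi p.
  by rewrite /phi !fctE/=; ring.
have := rem s 1 s01 i1; have := rem s 0 s01 i0.
have L a b : 'd ('D_u f) p (a *: u + b *: v) =
    a * 'd ('D_u f) p u + b * 'd ('D_u f) p v by rewrite linearD !linearZ.
rewrite !L; clear L.
rewrite E; have [_ ->] := derphi s s01.
rewrite (deriveE _ dfu).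
set A := 'D_u f (_ + (_ + (0 * _) *: _)); set B := 'D_u f p.
set C := 'D_u f (_ + (_ + (1 * _) *: _)).
set du := 'd _ _ u; set dv := 'd _ _ v.
set b := e / K * _ => h1 h2.
(* The u-parts [s * t * du] of the two expansions cancel, and only [t * dv] survives. *)
have -> : t * C - t * A - t ^+ 2 * dv =
   t * ((C - B - (s * t * du + 1 * t * dv)) - (A - B - (s * t * du + 0 * t * dv))).
  by ring.
rewrite normrM (@le_trans _ _ (`|t| * (2 * b)))//.
  rewrite ler_wpM2l// (le_trans (ler_normB _ _))// mulr_natl mulr2n.
  exact: lerD h2 h1.
rewrite -(real_normK (num_real t)) /b.
rewrite [leLHS](_ : _ = `|t| ^+ 2 * e * ((2 * (`|u| + `|v|)) / K)); last first.
  by field; rewrite gt_eqF.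
rewrite [leRHS]mulrC ler_piMr//; first by rewrite mulr_ge0 ?exprn_ge0// ltW.
by rewrite ler_pdivrMr// mul1r /K lerDl.
Qed.

(** The second difference is symmetric in u and v; divided by t^2 it is within e / 2 of either mixed
    derivative for one common small t. *)
Lemma schwarz (V : normedModType R) (f : V -> R) (p u v : V) :
  (\forall q \near p, differentiable f q) ->
  differentiable ('D_u f) p -> differentiable ('D_v f) p ->
  'D_v ('D_u f) p = 'D_u ('D_v f) p.
Proof.
move=> df du dv; apply/eqP; rewrite -subr_eq0 -normr_le0.
apply/ler_addgt0Pr => e e0; rewrite add0r.
have e20 : 0 < e / 2 by rewrite divr_gt0.
have /nbhs_ballP[r /= r0 rP] := second_difference v e20 df du.
have /nbhs_ballP[r' /= r'0 r'P] := second_difference u e20 df dv.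
pose t := Num.min r r' / 2.
have m0 : 0 < Num.min r r' by rewrite lt_min r0.
have t0 : 0 < t by rewrite divr_gt0.
have tm : t < Num.min r r' by rewrite /t; lra.
have := rP t; have := r'P t.
rewrite /ball/= sub0r normrN gtr0_norm//.
move: tm; rewrite lt_min => /andP[-> ->].
move=> /(_ isT) + /(_ isT).
rewrite [p + t *: v + _]addrAC; set a := f _; set b := f _; set c := f _.
set x := 'D_v _ _; set y := 'D_u _ _ => h1 h2.
have t20 : 0 < t ^+ 2 by rewrite exprn_gt0.
rewrite -(ler_pM2l t20) -{1}(gtr0_norm t20) -normrM.
rewrite [leLHS](_ : _ = `|(a - b - c + f p - t ^+ 2 * y)
   - (a - c - b + f p - t ^+ 2 * x)|); last by congr `|_|; ring.
apply: le_trans (ler_normB _ _) _; apply: le_trans (lerD h1 h2) _.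
by rewrite -mulrDl -splitr mulrC.
Qed.

Lemma derive_partial n (f : 'rV[R]_n -> R) p v :
  differentiable f p -> 'D_v f p = \sum_(i < n) partial i f p * v ord0 i.
Proof.
move=> df; rewrite deriveE// {1}(row_sum_delta v) linear_sum/=.
by apply: eq_bigr => i _; rewrite linearZ /partial deriveE// mulrC.
Qed.

Lemma diff_partial n (f : 'rV[R]_n -> R) p v :
  differentiable f p -> 'd f p v = \sum_(i < n) partial i f p * v ord0 i.
Proof. by move=> df; rewrite -deriveE// derive_partial. Qed.

End Calculus.

(** * The Poincare lemma *)

Section Poincare.
Context {R : realType}.

(** The indefinite integral, with exactly the regularity that the mean value theorem on [0, 1] asks
    for: continuity up to the ends and a derivative inside. *)
Lemma antiderivative01 (f : R -> R) : continuous f ->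
  exists F : R -> R, [/\ F 0 = 0, {within `[0, 1], continuous F} &
    forall t : R, 0 < t < 1 -> is_derive t 1 F (f t)].
Proof.
move=> cf; pose mu := @lebesgue_measure R.
have intf (b : R) : mu.-integrable `[0, b] (EFin \o f).
  apply: continuous_compact_integrable; first exact: segment_compact.
  exact: continuous_subspaceT.
exists (fun x => (\int[mu]_(t in `[0, x]) f t)%R); split.
- by rewrite set_itv1 Rintegral_set1.
- exact: (parameterized_integral_continuous ler01 (intf 1)).
- move=> t /andP[t0 t1].
  have [d e] := @continuous_FTC1_closed R f 0 t 1 t1 (intf 1) t0 (cf t).
  by apply: DeriveDef; [exact: d|rewrite -derive1E].
Qed.

(** Certifies a gradient guessed in advance: the linear form with coefficients [c] is continuous, so
    uniqueness of the differential identifies it with ['d u p]. *)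
Lemma differentiable_of_remainder n (u : 'rV[R]_n -> R) p (c : 'I_n -> R) :
  (forall e : R, 0 < e -> \forall h \near (0 : 'rV[R]_n),
     `|u (p + h) - u p - \sum_(i < n) c i * h ord0 i| <= e * `|h|) ->
  differentiable u p /\ forall i, partial i u p = c i.
Proof.
move=> rem; pose L (h : 'rV[R]_n) : R := \sum_(i < n) c i * h ord0 i.
have L_lin : linear L.
  move=> k a b; rewrite /L scaler_sumr -big_split/=; apply: eq_bigr => i _.
  by rewrite !mxE /GRing.scale/=; ring.
pose LL : {linear 'rV[R]_n -> R} :=
  HB.pack L (GRing.isLinear.Build _ _ _ _ _ L_lin).
have cL : continuous LL.
  move=> h; apply: differentiable_continuous.
  rewrite (_ : (LL : _ -> _) =
      \sum_(i < n) (c i \*: (fun q : 'rV[R]_n => q ord0 i))).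
    by apply: differentiable_sum => i; apply: differentiableZ;
       exact: differentiable_coord.
  by apply/funext => q; rewrite fct_sumE.
have E : u \o shift p = cst (u p) + LL +o_ (0 : 'rV[R]_n) id.
  apply/eqaddoP => e /rem; apply: filterS => h.
  by rewrite !fctE/= /shift/= opprD addrA [h + p]addrC.
have dE := diff_unique cL E.
have d : differentiable u p by apply/diff_locallyP; rewrite dE.
split=> // i; rewrite /partial deriveE// dE /= /L (bigD1 i)//= big1 => [|j ji].
  by rewrite mxE !eqxx mulr1 addr0.
by rewrite mxE (negPf ji) andbF mulr0.
Qed.

Lemma le_coord_norm n (h : 'rV[R]_n) i : `|h ord0 i| <= `|h|.
Proof.
by rewrite [leRHS]/Num.Def.normr/= mx_normrE; exact: (le_bigmax _ _ (ord0, i)).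
Qed.

(** Tube argument: by joint continuity the bound holds near each pair (t, 0), and compactness of
    [0, 1] extracts one neighbourhood of h = 0 that serves all t. *)
Lemma continuous_segment_uniform (V : normedModType R) (g : V -> R) (p : V)
    (e : R) :
  continuous g -> 0 < e ->
  \forall h \near (0 : V), forall t : R, 0 <= t <= 1 ->
    `|g (t *: p + h) - g (t *: p)| <= e.
Proof.
move=> cg e0.
have [+ _] := @compact_near_coveringP R `[0, 1]%classic.
move=> /(_ (@segment_compact _ _ _)).
move=> /(_ V (nbhs 0) (fun h t => `|g (t *: p + h) - g (t *: p)| <= e)).
move=> H; have {H} := H _ _.
move=> /(_ _) H; apply: filterS (H _) => [h P t t01|].
  by apply: P; rewrite /= in_itv.
  move=> t _.
  have : ((fun x : R * V => g (x.1 *: p + x.2) - g (x.1 *: p)) x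
            @[x --> (t, 0 : V)]) --> (0 : R).
    rewrite -[X in _ --> X](subrr (g (t *: p))) -{1}[t *: p]addr0.
    apply: cvgB; apply: (continuous_cvg _ (cg _)).
      apply: cvgD; last exact: cvg_snd.
      by apply: cvgZr_tmp; exact: cvg_fst.
    by apply: cvgZr_tmp; exact: cvg_fst.
  move=> /cvgrPdist_le/(_ _ e0); apply: filterS => -[t' h]/=.
  by rewrite sub0r normrN.
Qed.

(** The mean value theorem between tp and t(p + h) replaces the remainder by differences of partials
    of g at tp + sth and at tp; since |sth| <= |h|, these are small uniformly in t. *)
Lemma segment_remainder_uniform n (g : 'rV[R]_n -> R) (p : 'rV[R]_n) (e : R) :
  (forall q, differentiable g q) -> (forall j, continuous (partial j g)) ->
  0 < e -> \forall h \near (0 : 'rV[R]_n), forall t : R, 0 <= t <= 1 ->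
    `|g (t *: (p + h)) - g (t *: p) 
       - \sum_(i < n) partial i g (t *: p) * (t *: h) ord0 i| <= e * `|h|.
Proof.
(* Each of the n summands costs [e' * |h|]; dividing by n + 1 instead of n also covers n = 0. *)
move=> dg cg e0; pose e' := e / n.+1%:R.
have e'0 : 0 < e' by rewrite divr_gt0.
have H := @filter_forall _ 'I_n _ _ (nbhs_filter _)
  (fun j => continuous_segment_uniform p (cg j) e'0).
have [r /= r0 rP] := (nbhs_ballP _ _).1 H.
apply/nbhs_ballP; exists r => //= h hr t t01.
have [|s s01] := @line_mean_value R _ g (t *: p) (t *: h).
  by move=> s s01; exact: diff_derivable.
rewrite (scalerDr t p h) => ->; rewrite (derive_partial _ (dg _)).
rewrite -sumrB.
apply: (@le_trans _ _ (\sum_(i < n) e' * `|h|)); last first.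
  rewrite sumr_const card_ord -mulr_natr mulrAC ler_wpM2r//.
  by rewrite /e' -mulrA ler_piMr ?ltW// mulrC ltr_pdivrMr// mul1r ltr_nat.
apply: le_trans (ler_norm_sum _ _ _) _; apply: ler_sum => i _.
rewrite -mulrBl normrM ler_pM//.
  apply: (rP _ _ i t) => //; move: hr; rewrite -!ball_normE/= !sub0r !normrN.
  move: t01 s01 => /andP[t0 t1] /andP[s0 s1].
  apply: le_lt_trans; rewrite !normrZ !ger0_norm// mulrA.
  by rewrite ler_piMl// mulr_ile1.
rewrite mxE normrM; move: t01 => /andP[t0 t1].
by rewrite ger0_norm// (le_trans _ (le_coord_norm h i))// ler_piMl.
Qed.

(* The potential is the integral of the form along the segment from 0. *)
Lemma poincare n (w : 'I_n -> 'rV[R]_n -> R) :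
  (forall i q, differentiable (w i) q) ->
  (forall i j, continuous (partial j (w i))) ->
  (forall i j q, partial i (w j) q = partial j (w i) q) ->
  exists u : 'rV[R]_n -> R,
    forall q, differentiable u q /\ forall i, partial i u q = w i q.
Proof.
move=> dw cw closed.
have cline p i : continuous (fun t : R => w i (t *: p)).
  move=> t; apply: (continuous_cvg _ (differentiable_continuous (dw i _))).
  by apply: cvgZr_tmp; exact: cvg_id.
have anti (p : 'rV[R]_n) : exists F : R -> R,
    [/\ F 0 = 0, {within `[0, 1], continuous F} &
    forall t : R, 0 < t < 1 ->
      is_derive t 1 F (\sum_(i < n) p ord0 i * w i (t *: p))].
  apply: antiderivative01; apply: continuous_big => [|i _].
    exact: add_continuous.
  by move=> t; apply: cvgMl_tmp; exact: cline.
have [F FP] := choice anti.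
exists (fun p => F p 1) => p; apply: differentiable_of_remainder => e e0.
(* [K * e' * |h|] will bound phi': a Taylor remainder weighted by |p_i|, plus a difference of values
   of w_i weighted by |h_i| <= |h|, for each i. *)
pose K := \sum_(i < n) (`|p ord0 i| + 1).
have K0 : 0 <= K by apply: sumr_ge0 => i _; rewrite addr_ge0.
pose e' := e / (K + 1).
have e'0 : 0 < e' by rewrite divr_gt0// ltr_wpDl.
have H1 := @filter_forall _ 'I_n _ _ (nbhs_filter _)
  (fun i => segment_remainder_uniform p (dw i) (cw i) e'0).
have cw' i : continuous (w i) by move=> q; exact: differentiable_continuous.
have H2 := @filter_forall _ 'I_n _ _ (nbhs_filter _)
  (fun i => continuous_segment_uniform p (cw' i) e'0).
have [r1 /= r10 r1P] := (nbhs_ballP _ _).1 H1.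
have [r2 /= r20 r2P] := (nbhs_ballP _ _).1 H2.
apply/nbhs_ballP; exists (Num.min r1 r2) => /=; first by rewrite lt_min r10.
move=> h; rewrite -ball_normE /= sub0r normrN lt_min => /andP[hr1 hr2].
have rem i (t : R) : 0 <= t <= 1 ->
    `|w i (t *: (p + h)) - w i (t *: p) 
       - \sum_(j < n) partial j (w i) (t *: p) * (t *: h) ord0 j|
      <= e' * `|h|.
  by apply: r1P; rewrite -ball_normE /= sub0r normrN.
have dif i (t : R) : 0 <= t <= 1 ->
    `|w i (t *: (p + h)) - w i (t *: p)| <= e'.
  move=> /andP[t0 t1]; rewrite scalerDr; apply: (r2P _ _ i t); last by rewrite t0.
  rewrite -ball_normE /= sub0r normrN normrZ ger0_norm//.
  by apply: le_lt_trans hr2; rewrite ler_piMl.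
(* [G] runs from 0 at t = 0 to the candidate differential, the sum of w_i(p) h_i, at t = 1.
   Subtracting it makes the remainder of the potential equal to phi(1) - phi(0), so the mean value
   theorem replaces differentiation under the integral. *)
pose G : R -> R :=
  \sum_(i < n) h ord0 i *: ((id : R -> R) * (fun t : R => w i (t *: p))).
have GE t : G t = \sum_(i < n) h ord0 i * (t * w i (t *: p)).
  by rewrite /G fct_sumE.
have dline i (t : R) :
    is_derive t 1 (fun t : R => w i (t *: p)) ('D_p (w i) (t *: p)).
  have := @is_derive_line R _ _ (w i) 0 p t.
  rewrite add0r (_ : (fun t0 => w i (0 + t0 *: p)) = (fun t : R => w i (t *: p))).
    by apply; exact: diff_derivable.
  by apply/funext => s; rewrite add0r.
pose dG (t : R) := \sum_(i < n)
  h ord0 i *: (t *: 'D_p (w i) (t *: p) + w i (t *: p) *: (1 : R)).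
have dGP (t : R) : is_derive t 1 G (dG t).
  apply: is_derive_sum => i; apply: is_deriveZ; exact: is_deriveM.
pose phi : R -> R := F (p + h) - F p - G.
pose dphi t := \sum_(i < n)
  (p ord0 i * (w i (t *: (p + h)) - w i (t *: p)
       - \sum_(j < n) partial j (w i) (t *: p) * (t *: h) ord0 j)
   + h ord0 i * (w i (t *: (p + h)) - w i (t *: p))).
have [F0 cF dF] := FP p; have [F0' cF' dF'] := FP (p + h).
(* The form being closed, phi' is a sum of Taylor remainders. *)
have dphiE t : \sum_(i < n) (p + h) ord0 i * w i (t *: (p + h)) -
  \sum_(i < n) p ord0 i * w i (t *: p) - dG t = dphi t.
  rewrite /dG /dphi.
  under [X in _ - X]eq_bigr => i _.
    rewrite derive_partial// /GRing.scale/= mulr1 mulrDr.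
    rewrite (mulr_sumr _ _ _ t) mulr_sumr.
    under eq_bigr => j _ do rewrite closed.
    over.
  rewrite big_split/= exchange_big/= opprD -!sumrB -!sumrN -!big_split/=.
  apply: eq_bigr => i _; rewrite !mxE.
  rewrite (_ : \sum_(j < n) partial j (w i) (t *: p) * (t *: h) ord0 j =
    \sum_(j < n) t * (partial j (w i) (t *: p) * h ord0 j)); last first.
    by apply: eq_bigr => j _; rewrite !mxE; ring.
  rewrite (_ : \sum_(i0 < n) _ = p ord0 i * \sum_(j < n)
     t * (partial j (w i) (t *: p) * h ord0 j)); last first.
    by rewrite mulr_sumr; apply: eq_bigr => j _; ring.
  by ring.
have [||t t01] := @MVT_segment R phi dphi 0 1 ler01.
- move=> t; rewrite in_itv/= => t01; rewrite -dphiE.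
  by apply: is_deriveB; apply: is_deriveB; [exact: dF'|exact: dF].
- have cG : {within `[0, 1], continuous G}.
    apply: continuous_subspaceT => t; apply: differentiable_continuous.
    by apply/derivable1_diffP; case: (dGP t).
  move=> t; apply: cvgB; last exact: cG.
  by apply: cvgB; [exact: cF'|exact: cF].
- have t01' : 0 <= t <= 1 by move: t01; rewrite in_itv.
  rewrite subr0 mulr1 => E.
  have -> : F (p + h) 1 - F p 1 - \sum_(i < n) w i p * h ord0 i = phi 1 - phi 0.
    have G0 : G 0 = 0 by rewrite GE big1// => i _; rewrite mul0r mulr0.
    have G1 : G 1 = \sum_(i < n) w i p * h ord0 i.
      by rewrite GE; apply: eq_bigr => i _; rewrite scale1r mul1r mulrC.
    by rewrite /phi !fctE F0 F0' G0 G1 !subr0.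
  rewrite E (le_trans (ler_norm_sum _ _ _))//.
  apply: (@le_trans _ _ (\sum_(i < n) (`|p ord0 i| + 1) * (e' * `|h|))).
    apply: ler_sum => i _; rewrite (le_trans (ler_normD _ _))// !normrM mulrDl.
    apply: lerD; first by rewrite ler_wpM2l// rem.
    by rewrite mul1r mulrC ler_pM// ?dif// le_coord_norm.
  rewrite -mulr_suml mulrA ler_wpM2r// /e' mulrCA ler_piMr ?ltW//.
  by rewrite ltr_pdivrMr ?mul1r ?ltrDl// ltr_wpDl.
Qed.

End Poincare.

(** * Smooth functions on R^n *)

Section SmoothCalculus.
Context {R : realType} {n : nat}.
Implicit Types (f g u : 'rV[R]_n -> R) (U : set 'rV[R]_n).

Lemma smooth_differentiable U f p : smooth U f -> U p -> differentiable f p.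
Proof. by move=> /(_ [::] p). Qed.

Lemma smooth_partial U f i : smooth U f -> smooth U (partial i f).
Proof. by move=> sf s p Up; rewrite -foldr_rcons; exact: sf. Qed.

Lemma partial_cst (c : R) i : partial i (cst c : 'rV[R]_n -> R) = cst 0.
Proof. by apply/funext => p; exact: derive_cst. Qed.

Lemma smooth_cst (c : R) U : smooth U (cst c : 'rV[R]_n -> R).
Proof.
move=> s p _; suff [c' ->] : exists c', foldr partial (cst c) s = cst c'.
  exact: differentiable_cst.
elim: s => [|i s [c' /= ->]]; first by exists c.
by exists 0; rewrite partial_cst.
Qed.

Lemma partial_coord i j :
  partial i (fun p : 'rV[R]_n => p ord0 j) = cst (j == i)%:R.
Proof.
apply/funext => p; rewrite /partial deriveE; last exact: differentiable_coord.
pose L (q : 'rV[R]_n) := q ord0 j.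
have L_lin : linear L by move=> k a b; rewrite /L !mxE.
pose LL : {linear 'rV[R]_n -> R} :=
  HB.pack L (GRing.isLinear.Build _ _ _ _ _ L_lin).
rewrite (_ : (fun _ => _) = LL)// diff_lin; last exact: coord_continuous.
by rewrite /= /L mxE eqxx.
Qed.

Lemma smooth_coord U j : smooth U (fun p : 'rV[R]_n => p ord0 j).
Proof.
(* [foldr] applies the last index of [s] first, so splitting off the last element exposes the
   innermost derivative, which is constant. *)
move=> s p Up; elim/last_ind: s => [|s i _]; first exact: differentiable_coord.
by rewrite foldr_rcons partial_coord; exact: smooth_cst.
Qed.

Lemma partialD i f g p : differentiable f p -> differentiable g p ->
  partial i (f \+ g) p = partial i f p + partial i g p.
Proof. by move=> df dg; apply: deriveD; exact: diff_derivable. Qed.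

Lemma partialB i f g p : differentiable f p -> differentiable g p ->
  partial i (f \- g) p = partial i f p - partial i g p.
Proof. by move=> df dg; apply: deriveB; exact: diff_derivable. Qed.

Lemma partialM i f g p : differentiable f p -> differentiable g p ->
  partial i (f \* g) p = f p * partial i g p + g p * partial i f p.
Proof. by move=> df dg; apply: deriveM; exact: diff_derivable. Qed.

Lemma smoothD f g : smooth setT f -> smooth setT g -> smooth setT (f \+ g).
Proof.
move=> sf sg; suff E s : foldr partial (f \+ g) s =
    foldr partial f s \+ foldr partial g s.
  by move=> s p _; rewrite E; apply: differentiableD; [exact: sf|exact: sg].
elim: s => //= i s ->; apply/funext => p.
by rewrite partialD//; [exact: sf|exact: sg].
Qed.

Lemma smoothB f g : smooth setT f -> smooth setT g -> smooth setT (f \- g).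
Proof.
move=> sf sg; suff E s : foldr partial (f \- g) s =
    foldr partial f s \- foldr partial g s.
  by move=> s p _; rewrite E; apply: differentiableB; [exact: sf|exact: sg].
elim: s => //= i s ->; apply/funext => p.
by rewrite partialB//; [exact: sf|exact: sg].
Qed.

Lemma partial_comm f i j : smooth setT f ->
  partial i (partial j f) = partial j (partial i f).
Proof.
move=> sf; apply/funext => p; apply: schwarz.
- by near=> q; exact: (smooth_differentiable sf).
- exact: (smooth_differentiable (smooth_partial j sf)).
- exact: (smooth_differentiable (smooth_partial i sf)).
Unshelve. all: by end_near. Qed.

(** Smoothness of u costs nothing beyond differentiability: every further iterated partial of u is
    an iterated partial of some [w i]. *)
Lemma smooth_poincare (w : 'I_n -> 'rV[R]_n -> R) :
  (forall i, smooth setT (w i)) ->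
  (forall i j, partial i (w j) = partial j (w i)) ->
  exists2 u, smooth setT u & forall i, partial i u = w i.
Proof.
move=> sw cw; have [|||u uP] := @poincare R n w.
- by move=> i q; exact: (smooth_differentiable (sw i)).
- move=> i j q; apply: differentiable_continuous.
  exact: (smooth_differentiable (smooth_partial j (sw i))).
- by move=> i j q; rewrite cw.
have du i : partial i u = w i by apply/funext => q; have [_] := uP q; apply.
exists u => // s q _; elim/last_ind: s => [|s i _]; first by case: (uP q).
by rewrite foldr_rcons du; exact: sw.
Qed.

Lemma row_diff m (F : 'rV[R]_n -> 'rV[R]_m) p :
  (forall i, differentiable (fun q => F q ord0 i) p) ->
  differentiable F p /\
  forall v i, ('d F p v) ord0 i = 'd (fun q => F q ord0 i) p v.
Proof.
move=> dF; have d : differentiable F p.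
  rewrite (_ : F = \sum_(i < m)
      (fun q => F q ord0 i *: (delta_mx ord0 i : 'rV[R]_m))).
    by apply: differentiable_sum => i; exact: differentiableZl.
  by apply/funext => q; rewrite fct_sumE; exact: row_sum_delta.
split=> // v i; rewrite -!deriveE// derive_mx ?mxE//.
exact: diff_derivable.
Qed.

End SmoothCalculus.

(** * Functions on the jet space *)

Section Jets.
Context {R : realType}.
Implicit Types (F : 'rV[R]_5 -> R) (p v : 'rV[R]_5) (q : 'rV[R]_3).

Lemma base_index (i : 'I_3) : [\/ i = jx1, i = jx2 | i = jy].
Proof.
by case: i => -[|[|[|//]]] ?; [constructor 1|constructor 2|constructor 3];
  exact: val_inj.
Qed.

Lemma jet_index (i : 'I_5) :
  [\/ i = ix1, i = ix2 | i = iy] \/ (i = iz1 \/ i = iz2).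
Proof.
by case: i => -[|[|[|[|[|//]]]]] ?; [left; constructor 1|left; constructor 2
  |left; constructor 3|right; left|right; right]; exact: val_inj.
Qed.

Lemma jet_diff F p v : differentiable F p ->
  'd F p v = pd_x1 F p * x1 v + pd_x2 F p * x2 v + pd_y F p * y v
             + pd_z1 F p * z1 v + pd_z2 F p * z2 v.
Proof.
move=> dF; rewrite (diff_partial v dF) !big_ord_recl big_ord0 addr0 !addrA.
congr (_ + _ + _ + _ + _); congr (partial _ _ _ * v _ _); exact: val_inj.
Qed.

Lemma base_diff (G : 'rV[R]_3 -> R) q (v : 'rV[R]_3) : differentiable G q ->
  'd G q v = partial jx1 G q * v ord0 jx1 + partial jx2 G q * v ord0 jx2
             + partial jy G q * v ord0 jy.
Proof.
move=> dG; rewrite (diff_partial v dG) !big_ord_recl big_ord0 addr0 !addrA.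
congr (_ + _ + _); congr (partial _ _ _ * v _ _); exact: val_inj.
Qed.

Lemma J0_of_J1_linear (k : R) p v :
  J0_of_J1 (k *: p + v) = k *: J0_of_J1 p + J0_of_J1 v.
Proof.
by apply/rowP; case=> -[|[|[|//]]] ?; rewrite !mxE /= /x1 /x2 /y !mxE.
Qed.

Lemma J0_of_J1_delta (i : 'I_5) : J0_of_J1 (delta_mx ord0 i : 'rV[R]_5) =
  nth 0 [:: delta_mx ord0 jx1; delta_mx ord0 jx2; delta_mx ord0 jy] i.
Proof.
apply/rowP => j; rewrite mxE /x1 /x2 /y !mxE.
by case: i j => -[|[|[|[|[|//]]]]] ? [[|[|[|//]]] ?]; rewrite !mxE.
Qed.

(** By linearity of the projection the two difference quotients are the same function of h, so no
    chain rule is involved. *)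
Lemma derive_J0_of_J1 (G : 'rV[R]_3 -> R) p v :
  'D_v (G \o J0_of_J1) p = 'D_(J0_of_J1 v) G (J0_of_J1 p).
Proof.
have e : (fun h : R => h^-1 *: (((G \o J0_of_J1) \o shift p) (h *: v)
            - (G \o J0_of_J1) p)) =
         (fun h => h^-1 *: ((G \o shift (J0_of_J1 p)) (h *: J0_of_J1 v)
            - G (J0_of_J1 p))).
  by apply/funext => h /=; rewrite J0_of_J1_linear.
by rewrite /derive e.
Qed.

Lemma pd_J0_of_J1 (G : 'rV[R]_3 -> R) :
  [/\ pd_x1 (G \o J0_of_J1) = partial jx1 G \o J0_of_J1,
      pd_x2 (G \o J0_of_J1) = partial jx2 G \o J0_of_J1,
      pd_y (G \o J0_of_J1) = partial jy G \o J0_of_J1,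
      pd_z1 (G \o J0_of_J1) = cst 0 &
      pd_z2 (G \o J0_of_J1) = cst 0].
Proof.
by split; apply/funext => p;
  rewrite /pd_x1 /pd_x2 /pd_y /pd_z1 /pd_z2 /partial derive_J0_of_J1
          J0_of_J1_delta //= derive0.
Qed.

Lemma J0_of_J1_differentiable p : differentiable (@J0_of_J1 R) p.
Proof.
apply: (row_diff _).1; case=> -[|[|[|//]]] ?.
- rewrite (_ : (fun _ => _) = x1); first exact: differentiable_coord.
  by apply/funext => q; rewrite mxE.
- rewrite (_ : (fun _ => _) = x2); first exact: differentiable_coord.
  by apply/funext => q; rewrite mxE.
- rewrite (_ : (fun _ => _) = y); first exact: differentiable_coord.
  by apply/funext => q; rewrite mxE.
Qed.

Lemma differentiable_J0_of_J1 (G : 'rV[R]_3 -> R) p :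
  differentiable G (J0_of_J1 p) -> differentiable (G \o J0_of_J1) p.
Proof.
by move=> dG; apply: differentiable_comp dG; exact: J0_of_J1_differentiable.
Qed.

(** Realises every pair of slopes over a base point, so that A = 0 and B = 0 can be read as
    polynomial identities in the slopes. *)
Definition jet q (a b : R) : 'rV[R]_5 :=
  \row_(i < 5) [:: q ord0 jx1; q ord0 jx2; q ord0 jy; a; b]`_i.

Lemma jetE q a b :
  [/\ J0_of_J1 (jet q a b) = q, z1 (jet q a b) = a & z2 (jet q a b) = b].
Proof.
split; rewrite /z1 /z2 ?mxE//; apply/rowP.
by case=> -[|[|[|//]]] ?; rewrite mxE /= /x1 /x2 /y mxE /=; congr (q _ _);
  exact: val_inj.
Qed.

(** The shape of A and of B when the right-hand sides live on the base, with a and b the slopes z1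
    and z2. *)
Lemma affine2_eq0 (k l m n : R) :
  (forall a b : R, k + b * l - m - a * n = 0) -> [/\ k = m, l = 0 & n = 0].
Proof.
by move=> H; have := H 0 0; have := H 0 1; have := H 1 0; clear H; split; lra.
Qed.

Section PointEquation.
Variables P Q T : 'rV[R]_3 -> R.
Let E := Pde (P \o J0_of_J1) (Q \o J0_of_J1) (T \o J0_of_J1).

Lemma integrable_point_pde : integrable_pde E ->
  [/\ partial jy P = cst 0, partial jy Q = cst 0, partial jy T = cst 0,
      partial jx2 P = partial jx1 Q & partial jx2 Q = partial jx1 T].
Proof.
have [_ P2 Py Pz1 Pz2] := pd_J0_of_J1 P.
have [Q1 Q2 Qy Qz1 Qz2] := pd_J0_of_J1 Q.
have [T1 _ Ty Tz1 Tz2] := pd_J0_of_J1 T.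
move=> iE.
have AB q a b :
    partial jx2 P q + b * partial jy P q - partial jx1 Q q
      - a * partial jy Q q = 0 /\
    partial jx2 Q q + b * partial jy Q q - partial jx1 T q
      - a * partial jy T q = 0.
  have [] := iE (jet q a b); have := jetE q a b.
  move: (jet q a b) => p [e ea eb].
  rewrite /obstrA /obstrB /D1 /D2 /= P2 Py Pz1 Pz2 Q1 Q2 Qy Qz1 Qz2.
  rewrite T1 Ty Tz1 Tz2 /= e ea eb !mulr0 !addr0 !opprD !addrA.
  by split.
have PQ q := affine2_eq0 (fun a b => (AB q a b).1).
have QT q := affine2_eq0 (fun a b => (AB q a b).2).
by split; apply/funext => q; have [? ? ?] := PQ q; have [? ? ?] := QT q.
Qed.

End PointEquation.

Lemma nth3_smooth (a b c : 'rV[R]_3 -> R) : 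
  smooth setT a -> smooth setT b -> smooth setT c ->
  forall i : 'I_3, smooth setT (nth a [:: a; b; c] i).
Proof. by move=> sa sb sc [[|[|[|//]]] ?]. Qed.

(** The Poincare lemma for the form a dx1 + b dx2 on R^3: with a zero third component, closedness
    amounts to independence of y together with the one cross condition. *)
Lemma potential_base (a b : 'rV[R]_3 -> R) : smooth setT a -> smooth setT b ->
  partial jy a = cst 0 -> partial jy b = cst 0 ->
  partial jx2 a = partial jx1 b ->
  exists2 u, smooth setT u &
    [/\ partial jx1 u = a, partial jx2 u = b & partial jy u = cst 0].
Proof.
move=> sa sb ay by' ab.
have [||u su uP] := @smooth_poincare R 3 (fun i => nth a [:: a; b; cst 0] i).
- by apply: nth3_smooth => //; exact: smooth_cst.
- by move=> i j; case: (base_index i) => ->; case: (base_index j) => -> //=;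
    rewrite ?partial_cst ?ay ?by' ?ab.
- by exists u => //; rewrite !uP.
Qed.

End Jets.

(** * Flattening an integrable equation *)

Section Flatten.
Context {R : realType}.

Lemma diff_coord n (i : 'I_n) (p v : 'rV[R]_n) :
  'd (fun q : 'rV[R]_n => q ord0 i : R) p v = v ord0 i.
Proof.
rewrite diff_partial; last exact: differentiable_coord.
rewrite (bigD1 i)//= big1 => [|j ji]; rewrite partial_coord.
  by rewrite eqxx mul1r addr0.
by rewrite eq_sym (negPf ji) mul0r.
Qed.

Lemma dfun_jet (p v : 'rV[R]_5) :
  [/\ dfun x1 p v = x1 v, dfun x2 p v = x2 v, dfun y p v = y v,
      dfun z1 p v = z1 v & dfun z2 p v = z2 v].
Proof. by split; exact: diff_coord. Qed.

Lemma theta0E (p v : 'rV[R]_5) : theta0 p v = y v - z1 p * x1 v - z2 p * x2 v.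
Proof. by have [<- <- <- _ _] := dfun_jet p v. Qed.

Lemma theta1E (E : @pde R) (p v : 'rV[R]_5) :
  theta1 E p v = z1 v - rhs11 E p * x1 v - rhs12 E p * x2 v.
Proof. by have [<- <- _ <- _] := dfun_jet p v. Qed.

Lemma theta2E (E : @pde R) (p v : 'rV[R]_5) :
  theta2 E p v = z2 v - rhs12 E p * x1 v - rhs22 E p * x2 v.
Proof. by have [<- <- _ _ <-] := dfun_jet p v. Qed.

Lemma constant_along (u : 'rV[R]_3 -> R) i (q : 'rV[R]_3) (t : R) :
  smooth setT u -> partial i u = cst 0 -> u (q + t *: delta_mx ord0 i) = u q.
Proof.
move=> su ui; have [s _|s _] := @line_mean_value R _ u q (t *: delta_mx ord0 i).
  by apply: diff_derivable; exact: (smooth_differentiable su).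
rewrite deriveE; last exact: (smooth_differentiable su).
rewrite linearZ -deriveE; last exact: (smooth_differentiable su).
rewrite -[X in _ = _ *: X]/(partial i u _) ui /= scaler0 => /eqP.
by rewrite subr_eq0 => /eqP.
Qed.

(** * The transformation (x1, x2, y - u) and its lift *)

Section Shift.
Variables u a b : 'rV[R]_3 -> R.
Hypotheses (su : smooth setT u)
  (u1 : partial jx1 u = a) (u2 : partial jx2 u = b)
  (uy : partial jy u = cst 0).

Let Y : 'rV[R]_3 -> R := (fun q : 'rV[R]_3 => q ord0 jy) \- u.

Lemma scale_map_shift_diffeo :
  diffeo setT setT (scale_map id id Y).
Proof.
have smap (Z : 'rV[R]_3 -> R) : smooth setT Z ->
    smooth_map setT (scale_map id id Z).
  move=> sZ; case=> -[|[|[|//]]] ?.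
  - rewrite (_ : (fun _ => _) = fun q : 'rV[R]_3 => q ord0 jx1); first exact: smooth_coord.
    by apply/funext => q; rewrite mxE.
  - rewrite (_ : (fun _ => _) = fun q : 'rV[R]_3 => q ord0 jx2); first exact: smooth_coord.
    by apply/funext => q; rewrite mxE.
  - rewrite (_ : (fun _ => _) = Z)//.
    by apply/funext => q; rewrite mxE.
have row3 (p q : 'rV[R]_3) : p ord0 jx1 = q ord0 jx1 ->
    p ord0 jx2 = q ord0 jx2 -> p ord0 jy = q ord0 jy -> p = q.
  move=> e1 e2 e3; apply/rowP; case=> -[|[|[|//]]] h.
  - by rewrite (_ : Ordinal h = jx1); last exact: val_inj.
  - by rewrite (_ : Ordinal h = jx2); last exact: val_inj.
  - by rewrite (_ : Ordinal h = jy); last exact: val_inj.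
(* As u does not depend on y, changing the third coordinate leaves its value unchanged; hence y + u
   inverts y - u. *)
have uZ Z q : u (scale_map id id Z q) = u q.
  rewrite -[RHS](constant_along q (Z q - q ord0 jy) su uy); congr (u _).
  by apply: row3; rewrite !mxE/=; ring.
split; [exact: openT|exact: openT| |by []|].
  by apply: smap; apply: smoothB => //; exact: smooth_coord.
exists (scale_map id id ((fun q : 'rV[R]_3 => q ord0 jy) \+ u)); split => //.
- by apply: smap; apply: smoothD => //; exact: smooth_coord.
- by move=> q _; apply: row3; rewrite !mxE//= uZ !mxE /= /Y addrNK.
- by move=> q _; apply: row3; rewrite !mxE//= /Y/= uZ !mxE /= addrK.
Qed.

Hypotheses (sa : smooth setT a) (sb : smooth setT b)
  (ay : partial jy a = cst 0) (b_y : partial jy b = cst 0)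
  (ab : partial jx2 a = partial jx1 b).

Let E := Pde (partial jx1 a \o J0_of_J1) (partial jx2 a \o J0_of_J1)
  (partial jx2 b \o J0_of_J1).
Let Phi := scale_lift id id Y.

Lemma scale_lift_shift (p : 'rV[R]_5) :
  [/\ x1 (Phi p) = x1 p, x2 (Phi p) = x2 p, y (Phi p) = y p - u (J0_of_J1 p),
      z1 (Phi p) = z1 p - a (J0_of_J1 p) & z2 (Phi p) = z2 p - b (J0_of_J1 p)].
Proof.
have dY i q : partial i Y q = (jy == i)%:R - partial i u q.
  rewrite partialB ?partial_coord//; first exact: differentiable_coord.
  exact: (smooth_differentiable su).
have Jy : J0_of_J1 p ord0 jy = y p by rewrite mxE.
split; rewrite /Phi /scale_lift.
- by rewrite /x1 mxE.
- by rewrite /x2 mxE.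
- by rewrite {1}/y mxE /= /Y /= Jy.
- by rewrite /z1 mxE /= !dY u1 uy derive1_id /=; field.
- by rewrite /z2 mxE /= !dY u2 uy derive1_id /=; field.
Qed.

Lemma diff_scale_lift_shift (p v : 'rV[R]_5) :
  let q := J0_of_J1 p in
  [/\ x1 ('d Phi p v) = x1 v, x2 ('d Phi p v) = x2 v,
      y ('d Phi p v) = y v - (a q * x1 v + b q * x2 v),
      z1 ('d Phi p v) =
        z1 v - (partial jx1 a q * x1 v + partial jx2 a q * x2 v) &
      z2 ('d Phi p v) =
        z2 v - (partial jx1 b q * x1 v + partial jx2 b q * x2 v)].
Proof.
set q := J0_of_J1 p => /=.
have dJ w : smooth setT w -> differentiable (w \o J0_of_J1) p.
  by move=> sw; apply: differentiable_J0_of_J1; exact: (smooth_differentiable sw).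
have dJE w : smooth setT w -> partial jy w = cst 0 ->
    'd (w \o J0_of_J1) p v = partial jx1 w q * x1 v + partial jx2 w q * x2 v.
  move=> sw wy; rewrite (jet_diff v (dJ _ sw)).
  by have [-> -> -> -> ->] := pd_J0_of_J1 w; rewrite wy /= !mul0r !addr0.
have cB (i : 'I_5) : differentiable (fun p : 'rV[R]_5 => p ord0 i : R) p.
  exact: differentiable_coord.
have dB (i : 'I_5) w : smooth setT w ->
    differentiable ((fun p : 'rV[R]_5 => p ord0 i : R) - (w \o J0_of_J1)) p.
  by move=> sw; apply: differentiableB => //; exact: dJ.
have dBE (i : 'I_5) w : smooth setT w -> partial jy w = cst 0 ->
    'd ((fun p : 'rV[R]_5 => p ord0 i : R) - (w \o J0_of_J1)) p v =
    v ord0 i - (partial jx1 w q * x1 v + partial jx2 w q * x2 v).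
  by move=> sw wy; rewrite diffB//=; [rewrite dJE// diff_coord|exact: dJ].
have c1 : (fun q : 'rV[R]_5 => Phi q ord0 ix1) =
    (fun q : 'rV[R]_5 => q ord0 ix1).
  by apply/funext => r; have [] := scale_lift_shift r.
have c2 : (fun q : 'rV[R]_5 => Phi q ord0 ix2) =
    (fun q : 'rV[R]_5 => q ord0 ix2).
  by apply/funext => r; have [] := scale_lift_shift r.
have c3 : (fun q : 'rV[R]_5 => Phi q ord0 iy) =
    (fun q : 'rV[R]_5 => q ord0 iy) - (u \o J0_of_J1).
  by apply/funext => r; have [] := scale_lift_shift r.
have c4 : (fun q : 'rV[R]_5 => Phi q ord0 iz1) =
    (fun q : 'rV[R]_5 => q ord0 iz1) - (a \o J0_of_J1).
  by apply/funext => r; have [] := scale_lift_shift r.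
have c5 : (fun q : 'rV[R]_5 => Phi q ord0 iz2) =
    (fun q : 'rV[R]_5 => q ord0 iz2) - (b \o J0_of_J1).
  by apply/funext => r; have [] := scale_lift_shift r.
have [i|_ dPhi] := @row_diff R 5 5 Phi p.
  case: (jet_index i) => [[->|->|->]|[->|->]]; rewrite ?c1 ?c2 ?c3 ?c4 ?c5.
  - exact: differentiable_coord.
  - exact: differentiable_coord.
  - exact: dB.
  - exact: dB.
  - exact: dB.
rewrite /x1 /x2 /y /z1 /z2 !dPhi c1 c2 c3 c4 c5.
split; [exact: diff_coord|exact: diff_coord| |exact: dBE|exact: dBE].
by rewrite dBE// u1 u2.
Qed.

(** The pulled-back generators equal [theta0], [theta1], [theta2] one by one: the first derivatives
    of u in dY cancel those in Z_i, and dZ_i subtracts from dz_i the second derivatives of u. In the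
    last one, [ab] reconciles the derivative of b by x1 with the one of a by x2 that defines f12. *)
Lemma shift_flattens : locally_flat_under_scale E.
Proof.
move=> p; exists setT; split; [exact: openT|by []|].
exists setT, id, id, Y; split => //.
  by exists setT; exact: scale_map_shift_diffeo.
rewrite /= -/Phi; congr (span_on _ _ _ _); apply/funext => r; apply/funext => v.
- have [e1 e2 e3 e4 e5] := diff_scale_lift_shift r v.
  have [f1 f2 f3 f4 f5] := scale_lift_shift r.
  rewrite /pullback !theta0E e1 e2 e3 f4 f5; ring.
- have [e1 e2 e3 e4 e5] := diff_scale_lift_shift r v.
  have [_ _ _ e _] := dfun_jet (Phi r) ('d Phi r v).
  rewrite /pullback e e4 theta1E /=; ring.
- have [e1 e2 e3 e4 e5] := diff_scale_lift_shift r v.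
  have [_ _ _ _ e] := dfun_jet (Phi r) ('d Phi r v).
  rewrite /pullback e e5 theta2E /= ab; ring.
Qed.

End Shift.

(** Three potentials: a with gradient (P, Q, 0), b with gradient (Q, T, 0), and then u with gradient
    (a, b, 0), which exists because a_{x2} = Q = b_{x1}. *)
Lemma flat_of_integrable (P Q T : 'rV[R]_3 -> R) :
  smooth setT P -> smooth setT Q -> smooth setT T ->
  let E := Pde (P \o J0_of_J1) (Q \o J0_of_J1) (T \o J0_of_J1) in
  integrable_pde E -> locally_flat_under_scale E.
Proof.
move=> sP sQ sT E /integrable_point_pde[Py Qy Ty PQ QT].
have [a sa [a1 a2 ay]] := potential_base sP sQ Py Qy PQ.
have [b sb [b1 b2 b_y]] := potential_base sQ sT Qy Ty QT.
have ab : partial jx2 a = partial jx1 b by rewrite a2 b1.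
have [u su [u1 u2 uy]] := potential_base sa sb ay b_y ab.
have := shift_flattens su u1 u2 uy sa sb ay b_y ab.
by rewrite a1 a2 b2.
Qed.

End Flatten.

(** * Brackets of vector fields *)

Section Bracket.
Context {R : realType}.

(** Needed because the module of forms controls functions on a neighbourhood [N] only, while
    functions here are global. *)
Lemma near_eq_differentiable (V W : normedModType R) (f g : V -> W) (p : V) :
  (\forall q \near p, f q = g q) -> differentiable f p -> differentiable g p.
Proof.
move=> fg df.
have gE : g \o shift p = cst (g p) + 'd f p +o_ (0 : V) id.
  apply/eqaddoP => e e0; have /eqaddoP/(_ e e0) := diff_locally df.
  have fg0 : \forall h \near (0 : V), f (h + p) = g (h + p).
    have [r /= r0 rP] := (nbhs_ballP _ _).1 fg.
    apply/nbhs_ballP; exists r => //= h; rewrite -ball_normE /= sub0r => hr.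
    by apply: rP; rewrite -ball_normE /= opprD addrCA subrr addr0.
  apply: filterS2 fg0 => h /= E.
  by rewrite !fctE/= /shift E (nbhs_singleton fg).
apply/diff_locallyP; rewrite (diff_unique _ gE)//.
by have [] := (diff_locallyP _ _).1 df.
exact: diff_continuous.
Qed.

Definition vfield n (a : 'I_n -> 'rV[R]_n -> R) (F : 'rV[R]_n -> R)
    (p : 'rV[R]_n) : R :=
  \sum_(i < n) a i p * partial i F p.

Lemma partial_vfield n (b : 'I_n -> 'rV[R]_n -> R) F p i :
  (forall j, differentiable (b j) p) ->
  (forall j, differentiable (partial j F) p) ->
  partial i (vfield b F) p =
  \sum_(j < n)
    (b j p * partial i (partial j F) p + partial j F p * partial i (b j) p).
Proof.
move=> db dF; rewrite (_ : vfield b F = \sum_(j < n) (b j \* partial j F)).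
  rewrite /partial derive_sum => [|j].
    by apply: eq_bigr => j _; exact: (partialM i (db j) (dF j)).
  by apply: diff_derivable; exact: (differentiableM (db j) (dF j)).
by apply/funext => q; rewrite fct_sumE.
Qed.

(** The second-order terms have coefficients a_i b_j on one side and b_i a_j on the other; [schwarz]
    makes them cancel, so only derivatives of the coefficients remain. *)
Lemma vfield_bracket n (a b : 'I_n -> 'rV[R]_n -> R) F p :
  (forall j, differentiable (a j) p) -> (forall j, differentiable (b j) p) ->
  (\forall q \near p, differentiable F q) ->
  (forall j, differentiable (partial j F) p) ->
  vfield a (vfield b F) p - vfield b (vfield a F) p =
  \sum_(j < n) (vfield a (b j) p - vfield b (a j) p) * partial j F p.
Proof.
move=> da db dF ddF.
have E (c d : 'I_n -> 'rV[R]_n -> R) : (forall j, differentiable (d j) p) ->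
    vfield c (vfield d F) p =
    \sum_(i < n) \sum_(j < n) c i p * d j p * partial i (partial j F) p
    + \sum_(j < n) vfield c (d j) p * partial j F p.
  move=> dd; rewrite {1}/vfield; under eq_bigr do rewrite partial_vfield//.
  under eq_bigr do rewrite mulr_sumr.
  rewrite /= [X in _ + X](eq_bigr _ (fun j _ => mulr_suml _ _ _ _)).
  rewrite [X in _ + X]exchange_big -big_split/=; apply: eq_bigr => i _.
  by rewrite -big_split/=; apply: eq_bigr => j _; ring.
rewrite !E// exchange_big/= opprD addrACA -sumrB big1 ?add0r => [|j _].
  by rewrite -sumrB; apply: eq_bigr => j _; rewrite mulrBl.
rewrite -sumrB big1// => i _.
have -> : partial i (partial j F) p = partial j (partial i F) p.
  exact: (schwarz dF (ddF j) (ddF i)).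
by ring.
Qed.

End Bracket.

(** * The bracket of the total derivatives D1 and D2 *)

Section FlatIntegrable.
Context {R : realType}.
Implicit Types (E : @pde R).

Definition vD1 E (i : 'I_5) : 'rV[R]_5 -> R :=
  nth (cst 0) [:: cst 1; cst 0; z1; rhs11 E; rhs12 E] i.
Definition vD2 E (i : 'I_5) : 'rV[R]_5 -> R :=
  nth (cst 0) [:: cst 0; cst 1; z2; rhs12 E; rhs22 E] i.

Lemma big_jet (G : 'I_5 -> R) :
  \sum_(i < 5) G i = G ix1 + G ix2 + G iy + G iz1 + G iz2.
Proof.
rewrite !big_ord_recl big_ord0 addr0 !addrA.
congr (_ + _ + _ + _ + _); congr G; exact: val_inj.
Qed.

Lemma vD1E E F : vfield (vD1 E) F = D1 E F.
Proof.
by apply/funext => p; rewrite /vfield big_jet /vD1 /= mul1r mul0r addr0.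
Qed.

Lemma vD2E E F : vfield (vD2 E) F = D2 E F.
Proof.
by apply/funext => p; rewrite /vfield big_jet /vD2 /= mul1r mul0r add0r.
Qed.

(* D1 and D2 annihilate the forms theta_i, and their bracket is
   - A d/dz1 - B d/dz2. *)
Lemma obstruction_annihilates E (N : set 'rV[R]_5)
    (F k0 k1 k2 : 'rV[R]_5 -> R) p :
  open N -> N p ->
  differentiable (rhs11 E) p -> differentiable (rhs12 E) p ->
  differentiable (rhs22 E) p ->
  (forall q, N q -> differentiable F q) ->
  differentiable k0 p -> differentiable k1 p -> differentiable k2 p ->
  (forall q, N q -> forall v, 'd F q v =
     k0 q * theta0 q v + k1 q * theta1 E q v + k2 q * theta2 E q v) ->
  obstrA E p * pd_z1 F p + obstrB E p * pd_z2 F p = 0.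
Proof.
move=> oN Np df11 df12 df22 dF dk0 dk1 dk2 FE.
have nearN : \forall q \near p, N q by apply: open_nbhs_nbhs.
have dc j q : differentiable (fun q : 'rV[R]_5 => q ord0 j : R) q.
  exact: differentiable_coord.
have dvD1 j : differentiable (vD1 E j) p.
  by case: j => -[|[|[|[|[|//]]]]] ? //; exact: dc.
have dvD2 j : differentiable (vD2 E j) p.
  by case: j => -[|[|[|[|[|//]]]]] ? //; exact: dc.
(* The coordinate components of k0 theta0 + k1 theta1 + k2 theta2. They equal the partials of F on
   [N] and are visibly differentiable at p, which provides the second derivatives of F required by
   the bracket formula. *)
pose L (j : 'I_5) : 'rV[R]_5 -> R := nth (cst 0)
  [:: - (z1 * k0 + rhs11 E * k1 + rhs12 E * k2);
      - (z2 * k0 + rhs12 E * k1 + rhs22 E * k2); k0; k1; k2] j.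
have dL j : differentiable (L j) p.
  have dlin (f g h : 'rV[R]_5 -> R) : differentiable f p ->
      differentiable g p -> differentiable h p ->
      differentiable (- (f * k0 + g * k1 + h * k2)) p.
    move=> df dg dh.
    exact: (differentiableN (differentiableD (differentiableD
      (differentiableM df dk0) (differentiableM dg dk1)) (differentiableM dh dk2))).
  case: j => -[|[|[|[|[|//]]]]] ?; rewrite /L /=.
  - exact: (dlin _ _ _ (dc iz1 p) df11 df12).
  - exact: (dlin _ _ _ (dc iz2 p) df12 df22).
  - exact: dk0.
  - exact: dk1.
  - exact: dk2.
have FL j q : N q -> partial j F q = L j q.
  move=> Nq; rewrite /partial deriveE; last exact: dF.
  rewrite FE// theta0E theta1E theta2E /x1 /x2 /y /z1 /z2 !mxE.
  by case: j => -[|[|[|[|[|//]]]]] ?; rewrite /L/= ?fctE /= /z1 /z2; ring.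
have dpF j : differentiable (partial j F) p.
  apply: near_eq_differentiable (dL j).
  by apply: filterS nearN => q Nq; rewrite FL.
have D1F q : N q -> D1 E F q = 0.
  move=> Nq; rewrite /D1 /pd_x1 /pd_y /pd_z1 /pd_z2 !FL// /L /= !fctE; ring.
have D2F q : N q -> D2 E F q = 0.
  move=> Nq; rewrite /D2 /pd_x2 /pd_y /pd_z1 /pd_z2 !FL// /L /= !fctE; ring.
(* [D1 E F] and [D2 E F] are known to vanish on [N] only, which is enough for their partials at
   p. *)
have near0 (G : 'rV[R]_5 -> R) i :
    (forall q, N q -> G q = 0) -> partial i G p = 0.
  move=> G0; rewrite /partial (near_eq_derive (g := cst 0)) ?derive_cst//.
  by apply: filterS nearN => q /G0.
have D12 : D1 E (D2 E F) p = 0.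
  by rewrite -vD1E /vfield big1// => i _; rewrite (near0 _ _ D2F) mulr0.
have D21 : D2 E (D1 E F) p = 0.
  by rewrite -vD2E /vfield big1// => i _; rewrite (near0 _ _ D1F) mulr0.
have D1c (c : R) : D1 E (cst c) p = 0.
  by rewrite -vD1E /vfield big1// => i _; rewrite partial_cst mulr0.
have D2c (c : R) : D2 E (cst c) p = 0.
  by rewrite -vD2E /vfield big1// => i _; rewrite partial_cst mulr0.
(* D1 z2 and D2 z1 agree because f12 = f21; this removes the d/dy component of the bracket. *)
have D1z2 : D1 E z2 p = rhs12 E p.
  by rewrite /D1 /pd_x1 /pd_y /pd_z1 /pd_z2 !partial_coord /= !mulr0 !add0r mulr1.
have D2z1 : D2 E z1 p = rhs12 E p.
  rewrite /D2 /pd_x2 /pd_y /pd_z1 /pd_z2 !partial_coord /= !mulr0 !add0r.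
  by rewrite mulr1 addr0.
have ndF : \forall q \near p, differentiable F q by apply: filterS nearN.
have := vfield_bracket dvD1 dvD2 ndF dpF.
rewrite big_jet !vD1E !vD2E D12 D21 /vD1 /vD2 /=.
rewrite !D1c !D2c D1z2 D2z1 !subrr !mul0r !add0r.
rewrite /obstrA /obstrB -/(pd_z1 F p) -/(pd_z2 F p).
rewrite -[D1 E (rhs12 E) p - _]opprB -[D1 E (rhs22 E) p - _]opprB.
by rewrite !mulNr -opprD => /esym/eqP; rewrite oppr_eq0 => /eqP.
Qed.
End FlatIntegrable.

(** * Flat equations are integrable *)

Section ScaleFlat.
Context {R : realType}.

(** Smoothness of a scale transformation is given for X_i composed with a coordinate; this
    translates it to and from [derive1], the divisor in the lift. *)
Lemma partial_comp_coord n (X : R -> R) (i j : 'I_n) (q : 'rV[R]_n) :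
  partial i (fun q => X (q ord0 j)) q = if j == i then derive1 X (q ord0 j) else 0.
Proof.
have e : (fun h : R => h^-1 *: (((fun q : 'rV[R]_n => X (q ord0 j)) \o shift q)
            (h *: delta_mx ord0 i) - X (q ord0 j))) =
         (fun h : R => h^-1 *: (X (h * (j == i)%:R + q ord0 j) - X (q ord0 j))).
  by apply/funext => h /=; rewrite !mxE eqxx.
rewrite /partial /derive e; case: eqVneq => _ /=.
  rewrite /derive1 (_ : (fun h : R => _ *: (X (h * 1 + _) - _)) =
      (fun h => h^-1 *: (X (h + q ord0 j) - X (q ord0 j))))//.
  by apply/funext => h; rewrite mulr1.
rewrite (_ : (fun _ => _) = cst 0) ?lim_cst//.
by apply/funext => h; rewrite mulr0 add0r subrr scaler0.
Qed.

Lemma diff_left_inverse (V W : normedModType R) (f : V -> W) (g : W -> V)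
    (p v : V) (r : W) :
  f p = r -> (\forall q \near p, g (f q) = q) ->
  differentiable f p -> differentiable g r -> 'd g r ('d f p v) = v.
Proof.
move=> <- gf df dg; have dgf := differentiable_comp df dg.
have e : 'D_v (g \o f) p = v.
  by rewrite (near_eq_derive (g := id)) ?derive_id.
rewrite -[RHS]e (deriveE _ dgf).
exact: (esym (congr1 (fun F => F v) (diff_comp df dg))).
Qed.

(** * Nonvanishing of X_1', X_2' and Y_y *)

Section Jacobian.
Variables (U V : set 'rV[R]_3) (X1 X2 : R -> R) (Y : 'rV[R]_3 -> R).
Hypothesis dif : diffeo U V (scale_map X1 X2 Y).

Lemma scale_map_smooth :
  [/\ smooth U (fun q : 'rV[R]_3 => X1 (q ord0 jx1)),
      smooth U (fun q : 'rV[R]_3 => X2 (q ord0 jx2)) &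
      smooth U Y].
Proof.
case: dif => _ _ s _ _; split.
- have := s jx1; rewrite (_ : (fun _ => _) = fun q : 'rV[R]_3 => X1 (q ord0 jx1))//.
  by apply/funext => q; rewrite mxE.
- have := s jx2; rewrite (_ : (fun _ => _) = fun q : 'rV[R]_3 => X2 (q ord0 jx2))//.
  by apply/funext => q; rewrite mxE.
- have := s jy; rewrite (_ : (fun _ => _) = Y)//.
  by apply/funext => q; rewrite mxE.
Qed.

(** The differential of the inverse map is a two-sided inverse of the Jacobian. The first two rows
    are multiples of one coordinate, so surjectivity gives X_i' k = 1 for some k; the third row
    mixes all coordinates, but the column of d/dy is (0, 0, Y_y), and injectivity forbids it to
    vanish. *)
Lemma scale_jacobian q : U q ->
  [/\ derive1 X1 (q ord0 jx1) != 0, derive1 X2 (q ord0 jx2) != 0 &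
      partial jy Y q != 0].
Proof.
move=> Uq; case: (dif) => oU oV sphi phiV [psi [spsi psiU psiphi phipsi]].
set phi := scale_map X1 X2 Y in sphi phiV psiphi phipsi *.
have [sX1 sX2 sY] := scale_map_smooth.
have [dphi dphiE] := row_diff (fun i => smooth_differentiable (sphi i) Uq).
have [dpsi _] := row_diff (fun i => smooth_differentiable (spsi i) (phiV _ Uq)).
have c1 : (fun q : 'rV[R]_3 => phi q ord0 jx1) =
    (fun q : 'rV[R]_3 => X1 (q ord0 jx1)).
  by apply/funext => r; rewrite mxE.
have c2 : (fun q : 'rV[R]_3 => phi q ord0 jx2) =
    (fun q : 'rV[R]_3 => X2 (q ord0 jx2)).
  by apply/funext => r; rewrite mxE.
have c3 : (fun q : 'rV[R]_3 => phi q ord0 jy) = Y by apply/funext => r; rewrite mxE.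
have d1 v : ('d phi q v) ord0 jx1 = derive1 X1 (q ord0 jx1) * v ord0 jx1.
  rewrite dphiE c1 base_diff; last exact: (smooth_differentiable sX1).
  by rewrite !partial_comp_coord /= !mul0r !addr0.
have d2 v : ('d phi q v) ord0 jx2 = derive1 X2 (q ord0 jx2) * v ord0 jx2.
  rewrite dphiE c2 base_diff; last exact: (smooth_differentiable sX2).
  by rewrite !partial_comp_coord /= !mul0r add0r !addr0.
have d3 v : ('d phi q v) ord0 jy = partial jx1 Y q * v ord0 jx1 +
    partial jx2 Y q * v ord0 jx2 + partial jy Y q * v ord0 jy.
  rewrite dphiE c3 base_diff//; exact: (smooth_differentiable sY).
have nearU : \forall r \near q, psi (phi r) = r.
  have : \forall r \near q, U r by apply: open_nbhs_nbhs.
  by apply: filterS => r /psiphi.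
have nearV : \forall r \near phi q, phi (psi r) = r.
  have : \forall r \near phi q, V r.
    by apply: open_nbhs_nbhs; split => //; exact: phiV.
  by apply: filterS => r /phipsi.
have left v : 'd psi (phi q) ('d phi q v) = v
  := diff_left_inverse v erefl nearU dphi dpsi.
have right v : 'd phi q ('d psi (phi q) v) = v
  := diff_left_inverse v (psiphi q Uq) nearV dpsi dphi.
have nz (a k : R) (i : 'I_3) :
    a * k = (delta_mx ord0 i : 'rV[R]_3) ord0 i -> a != 0.
  rewrite mxE !eqxx => e; apply/eqP => a0; move: e; rewrite a0 mul0r => /eqP.
  by rewrite eq_sym oner_eq0.
split.
- exact: nz (etrans (esym (d1 _))
    (congr1 (fun w : 'rV[R]_3 => w ord0 jx1) (right (delta_mx ord0 jx1)))).
- exact: nz (etrans (esym (d2 _))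
    (congr1 (fun w : 'rV[R]_3 => w ord0 jx2) (right (delta_mx ord0 jx2)))).
- apply/eqP => Y0.
  have dphi0 : 'd phi q (delta_mx ord0 jy) = 0.
    apply/rowP => i; case: (base_index i) => ->; rewrite [RHS]mxE.
    + by rewrite [LHS]d1 mxE /= mulr0.
    + by rewrite [LHS]d2 mxE /= mulr0.
    + by rewrite [LHS]d3 Y0 mul0r !mxE /= !mulr0 !addr0.
  have := etrans (esym (left (delta_mx ord0 jy)))
    (etrans (congr1 ('d psi (phi q)) dphi0) (linear0 _)).
  move/rowP/(_ jy); rewrite !mxE !eqxx => /eqP.
  by rewrite oner_eq0.
Qed.

End Jacobian.

(* The function Z_i of the lift, with X_i' written as a partial derivative of
   a function on the base. *)
Definition lift_slope (D G Y : 'rV[R]_3 -> R) (z : 'rV[R]_5 -> R)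
    (p : 'rV[R]_5) : R :=
  ((D \o J0_of_J1) p + (partial jy Y \o J0_of_J1) p * z p) *
  ((fun q => (G q)^-1) \o J0_of_J1) p.

(** All ingredients except the slope itself come from the base, so among the z-derivatives only the
    one along the matching slope survives, with value Y_y / X_i'. *)
Lemma lift_slope_diff D G Y (i : 'I_5) p :
  differentiable D (J0_of_J1 p) -> differentiable G (J0_of_J1 p) ->
  differentiable (partial jy Y) (J0_of_J1 p) -> G (J0_of_J1 p) != 0 ->
  let Z := lift_slope D G Y (fun p : 'rV[R]_5 => p ord0 i) in
  [/\ differentiable Z p,
      pd_z1 Z p = (i == iz1)%:R * (partial jy Y (J0_of_J1 p) / G (J0_of_J1 p)) &
      pd_z2 Z p = (i == iz2)%:R * (partial jy Y (J0_of_J1 p) / G (J0_of_J1 p))].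
Proof.
move=> dD dG dY G0 Z.
have dz : differentiable (fun p : 'rV[R]_5 => p ord0 i : R) p.
  exact: differentiable_coord.
have dYz := differentiableM (differentiable_J0_of_J1 dY) dz.
have dA := differentiableD (differentiable_J0_of_J1 dD) dYz.
have dV : differentiable (fun q => (G q)^-1) (J0_of_J1 p).
  exact: differentiableV.
have dVJ := differentiable_J0_of_J1 dV.
have dZ := differentiableM dA dVJ.
have [_ _ _ D1 D2] := pd_J0_of_J1 D.
have [_ _ _ Y1 Y2] := pd_J0_of_J1 (partial jy Y).
have [_ _ _ V1 V2] := pd_J0_of_J1 (fun q => (G q)^-1).
have E j : (partial j (D \o J0_of_J1) p = 0) ->
   (partial j (partial jy Y \o J0_of_J1) p = 0) ->
   (partial j ((fun q => (G q)^-1) \o J0_of_J1) p = 0) ->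
   partial j Z p = (i == j)%:R * (partial jy Y (J0_of_J1 p) / G (J0_of_J1 p)).
  move=> eD eY eV; rewrite [LHS](partialM j dA dVJ) eV mulr0 add0r.
  rewrite [X in _ * X](partialD j (differentiable_J0_of_J1 dD) dYz) eD add0r.
  rewrite [X in _ * X](partialM j (differentiable_J0_of_J1 dY) dz) eY mulr0 addr0.
  by rewrite partial_coord /cst /=; ring.
split; [exact: dZ| |]; apply: E.
- by move: D1 => /(congr1 (fun F => F p)).
- by move: Y1 => /(congr1 (fun F => F p)).
- by move: V1 => /(congr1 (fun F => F p)).
- by move: D2 => /(congr1 (fun F => F p)).
- by move: Y2 => /(congr1 (fun F => F p)).
- by move: V2 => /(congr1 (fun F => F p)).
Qed.

Lemma integrable_of_flat (E : @pde R) :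
  (forall p, [/\ differentiable (rhs11 E) p, differentiable (rhs12 E) p &
     differentiable (rhs22 E) p]) ->
  locally_flat_under_scale E -> integrable_pde E.
Proof.
move=> dE flat p; have [N [oN Np [U [X1 [X2 [Y [[V dif] NU span]]]]]]] := flat p.
have [sX1 sX2 sY] := scale_map_smooth dif.
have [dE11 dE12 dE22] := dE p.
pose Phi := scale_lift X1 X2 Y.
pose G1 := partial jx1 (fun q : 'rV[R]_3 => X1 (q ord0 jx1)).
pose G2 := partial jx2 (fun q : 'rV[R]_3 => X2 (q ord0 jx2)).
pose Z1 := lift_slope (partial jx1 Y) G1 Y z1.
pose Z2 := lift_slope (partial jx2 Y) G2 Y z2.
have J1E (q : 'rV[R]_5) : J0_of_J1 q ord0 jx1 = x1 q by rewrite mxE.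
have J2E (q : 'rV[R]_5) : J0_of_J1 q ord0 jx2 = x2 q by rewrite mxE.
have PhiZ1 : (fun q : 'rV[R]_5 => Phi q ord0 iz1) = Z1.
  apply/funext => q; rewrite mxE /= /Z1 /lift_slope /= /G1 partial_comp_coord.
  by rewrite /= J1E.
have PhiZ2 : (fun q : 'rV[R]_5 => Phi q ord0 iz2) = Z2.
  apply/funext => q; rewrite mxE /= /Z2 /lift_slope /= /G2 partial_comp_coord.
  by rewrite /= J2E.
have dd U0 (g : 'rV[R]_3 -> R) q : smooth U0 g -> U0 (J0_of_J1 q) ->
    differentiable g (J0_of_J1 q).
  by move=> sg; exact: smooth_differentiable.
have G10 q : N q -> G1 (J0_of_J1 q) != 0.
  move=> Nq; have [+ _ _] := scale_jacobian dif (NU q Nq).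
  by rewrite /G1 partial_comp_coord.
have G20 q : N q -> G2 (J0_of_J1 q) != 0.
  move=> Nq; have [_ + _] := scale_jacobian dif (NU q Nq).
  by rewrite /G2 partial_comp_coord.
have Y0 q : N q -> partial jy Y (J0_of_J1 q) != 0.
  by move=> Nq; have [_ _] := scale_jacobian dif (NU q Nq).
have Z1P q (Nq : N q) := lift_slope_diff iz1
  (dd _ _ q (smooth_partial jx1 sY) (NU q Nq))
  (dd _ _ q (smooth_partial jx1 sX1) (NU q Nq))
  (dd _ _ q (smooth_partial jy sY) (NU q Nq)) (G10 q Nq).
have Z2P q (Nq : N q) := lift_slope_diff iz2
  (dd _ _ q (smooth_partial jx2 sY) (NU q Nq))
  (dd _ _ q (smooth_partial jx2 sX2) (NU q Nq))
  (dd _ _ q (smooth_partial jy sY) (NU q Nq)) (G20 q Nq).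
have dZ1 q : N q -> differentiable Z1 q by move=> Nq; have [] := Z1P q Nq.
have dZ2 q : N q -> differentiable Z2 q by move=> Nq; have [] := Z2P q Nq.
have dPhi q : N q ->
    forall i, differentiable (fun q : 'rV[R]_5 => Phi q ord0 i) q.
  move=> Nq i; case: (jet_index i) => [[->|->|->]|[->|->]].
  - rewrite (_ : (fun _ => _) = (fun q : 'rV[R]_3 => X1 (q ord0 jx1)) \o J0_of_J1).
      by apply: differentiable_J0_of_J1; exact: (dd _ _ _ sX1 (NU q Nq)).
    by apply/funext => r; rewrite mxE /= J1E.
  - rewrite (_ : (fun _ => _) = (fun q : 'rV[R]_3 => X2 (q ord0 jx2)) \o J0_of_J1).
      by apply: differentiable_J0_of_J1; exact: (dd _ _ _ sX2 (NU q Nq)).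
    by apply/funext => r; rewrite mxE /= J2E.
  - rewrite (_ : (fun _ => _) = Y \o J0_of_J1).
      by apply: differentiable_J0_of_J1; exact: (dd _ _ _ sY (NU q Nq)).
    by apply/funext => r; rewrite mxE.
  - by rewrite PhiZ1; exact: dZ1.
  - by rewrite PhiZ2; exact: dZ2.
have pb1 q v : N q -> pullback Phi (dfun z1) q v = 'd Z1 q v.
  move=> Nq; have [_ _ _ e _] := dfun_jet (Phi q) ('d Phi q v).
  by rewrite /pullback e /z1 (row_diff (dPhi q Nq)).2 PhiZ1.
have pb2 q v : N q -> pullback Phi (dfun z2) q v = 'd Z2 q v.
  move=> Nq; have [_ _ _ _ e] := dfun_jet (Phi q) ('d Phi q v).
  by rewrite /pullback e /z2 (row_diff (dPhi q Nq)).2 PhiZ2.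
(* Of the equality of modules only this is used: the pullback of dz1, and below that of dz2, is a
   generator on one side, hence a combination of the thetas with coefficients smooth on [N]. *)
have in1 : span_on N theta0 (theta1 E) (theta2 E) (pullback Phi (dfun z1)).
  rewrite -span /Phi; exists (cst 0), (cst 1), (cst 0).
  by split; try exact: smooth_cst; move=> q Nq v /=; rewrite !mul0r mul1r add0r addr0.
have in2 : span_on N theta0 (theta1 E) (theta2 E) (pullback Phi (dfun z2)).
  rewrite -span /Phi; exists (cst 0), (cst 0), (cst 1).
  by split; try exact: smooth_cst; move=> q Nq v /=; rewrite !mul0r mul1r !add0r.
split.
- have [k0 [k1 [k2 [s0 s1 s2 kE]]]] := in1.
  have := @obstruction_annihilates R E N Z1 k0 k1 k2 p oN Np dE11 dE12 dE22 dZ1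
    (smooth_differentiable s0 Np) (smooth_differentiable s1 Np)
    (smooth_differentiable s2 Np) (fun q Nq v =>
      etrans (esym (pb1 q v Nq)) (kE q Nq v)).
  have [_ -> ->] := Z1P p Np; rewrite /= mul1r mul0r mulr0 addr0 => /eqP.
  rewrite mulf_eq0 => /orP[/eqP//|].
  by rewrite mulf_eq0 invr_eq0 (negPf (Y0 p Np)) (negPf (G10 p Np)).
- have [k0 [k1 [k2 [s0 s1 s2 kE]]]] := in2.
  have := @obstruction_annihilates R E N Z2 k0 k1 k2 p oN Np dE11 dE12 dE22 dZ2
    (smooth_differentiable s0 Np) (smooth_differentiable s1 Np)
    (smooth_differentiable s2 Np) (fun q Nq v =>
      etrans (esym (pb2 q v Nq)) (kE q Nq v)).
  have [_ -> ->] := Z2P p Np; rewrite /= mul1r mul0r mulr0 add0r => /eqP.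
  rewrite mulf_eq0 => /orP[/eqP//|].
  by rewrite mulf_eq0 invr_eq0 (negPf (Y0 p Np)) (negPf (G20 p Np)).
Qed.

End ScaleFlat.

(** * Exterior derivatives *)

Section ExteriorDerivative.
Context {R : realType}.

Lemma linear_fun_diff (V W : normedModType R) (f : V -> W) :
  linear f -> continuous f ->
  forall e, differentiable f e /\ forall v, 'd f e v = f v.
Proof.
move=> lf cf e.
pose L : {linear V -> W} := HB.pack f (GRing.isLinear.Build _ _ _ _ _ lf).
have cL : continuous L by [].
split; first exact: (linear_differentiable e cL).
by move=> v; exact: (congr1 (fun F => F v) (diff_lin e cL)).
Qed.

Section Rules.
Context {V : normedModType R}.
Implicit Types (w : form1 V) (e u v : V).

(** Differentiability of the components travels with the value of [dform], because ['d] of a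
    non-differentiable function is a default value; in this form the rules of exterior calculus
    compose. *)
Definition has_dform w e (W : V -> V -> R) :=
  (forall v, differentiable (fun q => w q v) e) /\ dform w e = W.

Lemma has_dform_eq w e W W' :
  has_dform w e W -> (forall u v, W u v = W' u v) -> has_dform w e W'.
Proof.
by move=> H E; rewrite (_ : W' = W)//; apply/funext => u; apply/funext => v.
Qed.

Lemma has_dformD w1 w2 e W1 W2 : has_dform w1 e W1 -> has_dform w2 e W2 ->
  has_dform (w1 + w2) e (fun u v => W1 u v + W2 u v).
Proof.
move=> [d1 <-] [d2 <-]; split=> [v|]; first exact: (differentiableD (d1 v) (d2 v)).
apply/funext => u; apply/funext => v; rewrite /dform.
have E a b : 'd (fun q => (w1 + w2) q a) e b =
    'd (fun q => w1 q a) e b + 'd (fun q => w2 q a) e b.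
  exact: (congr1 (fun F => F b) (diffD (d1 a) (d2 a))).
have abs (x y z t : R) : x + y - (z + t) = x - z + (y - t) by ring.
exact: etrans (congr2 (fun x y => x - y) (E v u) (E u v)) (abs _ _ _ _).
Qed.

Lemma has_dformB w1 w2 e W1 W2 : has_dform w1 e W1 -> has_dform w2 e W2 ->
  has_dform (w1 - w2) e (fun u v => W1 u v - W2 u v).
Proof.
move=> [d1 <-] [d2 <-]; split=> [v|]; first exact: (differentiableB (d1 v) (d2 v)).
apply/funext => u; apply/funext => v; rewrite /dform.
have E a b : 'd (fun q => (w1 - w2) q a) e b =
    'd (fun q => w1 q a) e b - 'd (fun q => w2 q a) e b.
  exact: (congr1 (fun F => F b) (diffB (d1 a) (d2 a))).
have abs (x y z t : R) : x - y - (z - t) = x - z - (y - t) by ring.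
exact: etrans (congr2 (fun x y => x - y) (E v u) (E u v)) (abs _ _ _ _).
Qed.

Lemma has_dformZ (m : V -> R) w e W : differentiable m e -> has_dform w e W ->
  has_dform (m \*f w) e
    (fun u v => 'd m e u * w e v - 'd m e v * w e u + m e * W u v).
Proof.
move=> dm [d <-]; split=> [v|]; first exact: (differentiableM dm (d v)).
apply/funext => u; apply/funext => v; rewrite /dform.
have E a b : 'd (fun q => (m \*f w) q a) e b =
    m e * 'd (fun q => w q a) e b + w e a * 'd m e b.
  exact: (congr1 (fun F => F b) (diffM dm (d a))).
have abs (k x a b y c t : R) :
    k * x + a * b - (k * y + c * t) = b * a - t * c + k * (x - y) by ring.
exact: etrans (congr2 (fun x y => x - y) (E v u) (E u v)) (abs _ _ _ _ _ _ _).
Qed.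

Lemma has_dform_dfun (f : V -> R) e : linear f -> continuous f ->
  has_dform (dfun f) e (fun _ _ => 0).
Proof.
move=> lf cf.
have E a : (fun q => dfun f q a) = cst (f a).
  by apply/funext => q; exact: (linear_fun_diff lf cf q).2.
split=> [v|]; first by rewrite E; exact: differentiable_cst.
apply/funext => u; apply/funext => v; rewrite /dform !E.
have Z a b : 'd (cst a : V -> R) e b = 0 by rewrite (diff_cst a e).
exact: etrans (congr2 (fun x y => x - y) (Z _ _) (Z _ _)) (subrr _).
Qed.

End Rules.

Lemma pullback_fst (V W : normedModType R) (w : form1 V) (e v : V * W) :
  pullback fst w e v = w e.1 v.1.
Proof.
have lf : linear (@fst V W) by [].
have cf : continuous (@fst V W) by move=> x; exact: cvg_fst.
by rewrite /pullback (linear_fun_diff lf cf e).2.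
Qed.

Lemma has_dform_fst (V W : normedModType R) (w : form1 V) (e : V * W) D :
  has_dform w e.1 D ->
  has_dform (pullback fst w) e (fun u v => D u.1 v.1).
Proof.
have lf : linear (@fst V W) by [].
have cf : continuous (@fst V W) by move=> x; exact: cvg_fst.
have [df fE] := linear_fun_diff lf cf e.
move=> [d <-].
pose g (a : V) : V -> R := fun q => w q a.
have E (a : V * W) : (fun q => @pullback R (V * W)%type V fst w q a) =
    g a.1 \o (@fst V W).
  by apply/funext => q; rewrite pullback_fst.
split=> [v|]; first by rewrite E; exact: (differentiable_comp df (d _)).
apply/funext => u; apply/funext => v; rewrite /dform !E.
have C (a b : V * W) : 'd (g a.1 \o (@fst V W)) e b = 'd (g a.1) (fst e) (fst b).
  exact: etrans (congr1 (fun F => F b) (diff_comp df (d a.1)))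
    (congr1 ('d (g a.1) (fst e)) (fE b)).
exact: (congr2 (fun x y => x - y) (C v u) (C u v)).
Qed.

(** d(1/m) is a multiple of dm, and dm wedge dm = 0. *)
Lemma has_dform_dlog (m : 'rV[R]_5 * 'rV[R]_4 -> R) e :
  linear m -> continuous m -> m e != 0 ->
  has_dform (dlog m) e (fun _ _ => 0).
Proof.
move=> lm cm m0; have [dm mE] := linear_fun_diff lm cm e.
apply: has_dform_eq (has_dformZ (differentiableV dm m0) (has_dform_dfun e lm cm)) _.
move=> u v; rewrite mulr0 addr0.
have E a : 'd (fun q => (m q)^-1) e a = - (m e) ^- 2 * m a.
  by rewrite -(mE a); exact: (congr1 (fun F => F a) (diffV dm m0)).
have abs (k x y : R) : k * x * y - k * y * x = 0 by ring.
by rewrite !E /dfun !mE abs.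
Qed.

End ExteriorDerivative.

(** * Consequences of the integrability condition *)

Section Curvature.
Context {R : realType}.
Variables f11 f12 f22 : 'rV[R]_5 -> R.
Let E := Pde f11 f12 f22.
Hypotheses (s11 : smooth setT f11) (s12 : smooth setT f12)
  (s22 : smooth setT f22).

Let dsm (F : 'rV[R]_5 -> R) p : smooth setT F -> differentiable F p.
Proof. by move=> sF; exact: (smooth_differentiable sF). Qed.

Lemma vD1_differentiable j p : differentiable (vD1 E j) p.
Proof.
case: j => -[|[|[|[|[|//]]]]] ?; [exact: differentiable_cst|
  exact: differentiable_cst|exact: differentiable_coord|exact: dsm|exact: dsm].
Qed.

Lemma vD2_differentiable j p : differentiable (vD2 E j) p.
Proof.
case: j => -[|[|[|[|[|//]]]]] ?; [exact: differentiable_cst|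
  exact: differentiable_cst|exact: differentiable_coord|exact: dsm|exact: dsm].
Qed.

Let vfield_partial a (F : 'rV[R]_5 -> R) i p : smooth setT F ->
  \sum_(j < 5) a j p * partial i (partial j F) p = vfield a (partial i F) p.
Proof. by move=> sF; apply: eq_bigr => j _; rewrite (partial_comm i j sF). Qed.

(** The extra terms are the commutator of the coordinate derivative with D1: it differentiates the
    coefficients z1, f11, f12, while those of d/dx1 and d/dx2 are constant. *)
Lemma partial_D1 (F : 'rV[R]_5 -> R) i p : smooth setT F ->
  partial i (D1 E F) p = D1 E (partial i F) p + ((iz1 == i)%:R * pd_y F p
    + partial i f11 p * pd_z1 F p + partial i f12 p * pd_z2 F p).
Proof.
move=> sF; have dF j : differentiable (partial j F) p.
  exact: (dsm _ (smooth_partial j sF)).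
rewrite -vD1E (partial_vfield i (fun j => vD1_differentiable j p) dF) big_split.
congr (_ + _); first by rewrite vfield_partial// vD1E.
have e1 : partial i (vD1 E ix1) p = 0 by exact: (congr1 (fun F => F p) (partial_cst _ i)).
have e2 : partial i (vD1 E ix2) p = 0 by exact: (congr1 (fun F => F p) (partial_cst _ i)).
have e3 : partial i (vD1 E iy) p = (iz1 == i)%:R.
  exact: (congr1 (fun F => F p) (partial_coord i iz1)).
have abs (a b c d e k l m : R) :
    a * 0 + b * 0 + c * k + d * l + e * m = k * c + l * d + m * e by ring.
by apply: etrans (big_jet _) _; rewrite e1 e2 e3; exact: abs.
Qed.

Lemma partial_D2 (F : 'rV[R]_5 -> R) i p : smooth setT F ->
  partial i (D2 E F) p = D2 E (partial i F) p + ((iz2 == i)%:R * pd_y F p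
    + partial i f12 p * pd_z1 F p + partial i f22 p * pd_z2 F p).
Proof.
move=> sF; have dF j : differentiable (partial j F) p.
  exact: (dsm _ (smooth_partial j sF)).
rewrite -vD2E (partial_vfield i (fun j => vD2_differentiable j p) dF) big_split.
congr (_ + _); first by rewrite vfield_partial// vD2E.
have e1 : partial i (vD2 E ix1) p = 0 by exact: (congr1 (fun F => F p) (partial_cst _ i)).
have e2 : partial i (vD2 E ix2) p = 0 by exact: (congr1 (fun F => F p) (partial_cst _ i)).
have e3 : partial i (vD2 E iy) p = (iz2 == i)%:R.
  exact: (congr1 (fun F => F p) (partial_coord i iz2)).
have abs (a b c d e k l m : R) :
    a * 0 + b * 0 + c * k + d * l + e * m = k * c + l * d + m * e by ring.
by apply: etrans (big_jet _) _; rewrite e1 e2 e3; exact: abs.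
Qed.

Lemma vfield_differentiable b (F : 'rV[R]_5 -> R) p :
  (forall j, differentiable (b j) p) -> smooth setT F ->
  differentiable (vfield b F) p.
Proof.
move=> db sF; rewrite (_ : vfield b F = \sum_(j < 5) (b j \* partial j F)).
  apply: differentiable_sum => j.
  exact: (differentiableM (db j) (dsm _ (smooth_partial j sF))).
by apply/funext => q; rewrite fct_sumE.
Qed.

Hypothesis iE : integrable_pde E.

Lemma D2_f11 p : D2 E f11 p = D1 E f12 p.
Proof. by apply/eqP; rewrite -subr_eq0; apply/eqP; have [] := iE p. Qed.

Lemma D2_f12 p : D2 E f12 p = D1 E f22 p.
Proof. by apply/eqP; rewrite -subr_eq0; apply/eqP; have [] := iE p. Qed.

(** The derivative of A = 0 by z1, after cancelling the product of (f11)_{z1} and (f12)_{z1} common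
    to both sides; it yields the stated form of S_6. *)
Lemma pd_z1_obstrA p : D2 E (pd_z1 f11) p + pd_z1 f22 p * pd_z2 f11 p =
  D1 E (pd_z1 f12) p + pd_y f12 p + pd_z1 f12 p * pd_z2 f12 p.
Proof.
have e : D2 E f11 = D1 E f12 by apply/funext => q; exact: D2_f11.
have := congr1 (fun F => partial iz1 F p) e.
rewrite (partial_D1 _ _ s12) (partial_D2 _ _ s11) /= => e'.
have abs (a t x c d j k g : R) :
    a + (0 * j + t * x + c) = d + (1 * k + x * t + g) -> a + c = d + k + g.
  by lra.
exact: abs e'.
Qed.

(** The previous identity differentiated by z2; it eliminates D1 of (f12)_{z1z2} from S_1. *)
Lemma pd_z2_pd_z1_obstrA p :
  D2 E (pd_z2 (pd_z1 f11)) p + pd_y (pd_z1 f11) p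
  + pd_z2 f12 p * pd_z1 (pd_z1 f11) p + pd_z2 f22 p * pd_z2 (pd_z1 f11) p
  + pd_z2 (pd_z1 f22) p * pd_z2 f11 p + pd_z1 f22 p * pd_z2 (pd_z2 f11) p =
  D1 E (pd_z2 (pd_z1 f12)) p + pd_z2 f11 p * pd_z1 (pd_z1 f12) p
  + 2 * (pd_z2 f12 p * pd_z2 (pd_z1 f12) p) + pd_y (pd_z2 f12) p
  + pd_z1 f12 p * pd_z2 (pd_z2 f12) p.
Proof.
have e : (D2 E (pd_z1 f11)) \+ (pd_z1 f22 \* pd_z2 f11) =
    (D1 E (pd_z1 f12)) \+ pd_y f12 \+ (pd_z1 f12 \* pd_z2 f12).
  by apply/funext => q; exact: pd_z1_obstrA.
have ep := congr1 (fun F => partial iz2 F p) e.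
have sz (F : 'rV[R]_5 -> R) : smooth setT F -> smooth setT (pd_z1 F) by exact: smooth_partial.
have sz2 (F : 'rV[R]_5 -> R) : smooth setT F -> smooth setT (pd_z2 F) by exact: smooth_partial.
have sy (F : 'rV[R]_5 -> R) : smooth setT F -> smooth setT (pd_y F) by exact: smooth_partial.
have dD2 : differentiable (D2 E (pd_z1 f11)) p.
  rewrite -vD2E; apply: vfield_differentiable; last exact: sz.
  by move=> j; exact: vD2_differentiable.
have dD1 : differentiable (D1 E (pd_z1 f12)) p.
  rewrite -vD1E; apply: vfield_differentiable; last exact: sz.
  by move=> j; exact: vD1_differentiable.
have d1 F : smooth setT F -> differentiable (pd_z1 F) p by move=> /sz/dsm.
have d2 F : smooth setT F -> differentiable (pd_z2 F) p by move=> /sz2/dsm.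
have dy F : smooth setT F -> differentiable (pd_y F) p by move=> /sy/dsm.
have eL := etrans (partialD iz2 dD2 (differentiableM (d1 _ s22) (d2 _ s11)))
  (congr2 (fun x y => x + y) (partial_D2 iz2 p (sz _ s11))
    (partialM iz2 (d1 _ s22) (d2 _ s11))).
have eR := etrans (partialD iz2 (differentiableD dD1 (dy _ s12))
    (differentiableM (d1 _ s12) (d2 _ s12)))
  (congr2 (fun x y => x + y) (etrans (partialD iz2 dD1 (dy _ s12))
    (congr2 (fun x y => x + y) (partial_D1 iz2 p (sz _ s12))
      (congr1 (fun F => F p) (partial_comm iz2 iy s12))))
    (partialM iz2 (d1 _ s12) (d2 _ s12))).
have := etrans (esym eL) (etrans ep eR); clear eL eR ep.
rewrite /= -!/(pd_z2 _) -!/(pd_y _).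
move: (D2 E _ p) (D1 E _ p) (pd_y (pd_z1 f11) p) (pd_z2 f12 p)
  (pd_z1 (pd_z1 f11) p) (pd_z2 f22 p) (pd_z2 (pd_z1 f11) p)
  (pd_z2 (pd_z1 f22) p) (pd_z2 f11 p) (pd_z1 f22 p)
  (pd_z2 (pd_z2 f11) p) (pd_y (pd_z1 f12) p) (pd_y f12 p)
  (pd_z1 (pd_z1 f12) p) (pd_z2 (pd_z1 f12) p) (pd_y (pd_z2 f12) p)
  (pd_z1 f12 p) (pd_z2 (pd_z2 f12) p).
move=> a b c d e' f g h i j k r s l m n o q H.
lra.
Qed.

End Curvature.

(** * The coframe on the jet space *)

Section Coframe.
Context {R : realType}.
Notation Amb := ('rV[R]_5 * 'rV[R]_4)%type.

Lemma coord_linear n (i : 'I_n) : linear (fun p : 'rV[R]_n => p ord0 i : R).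
Proof. by move=> k a b; rewrite !mxE. Qed.

Lemma coord_cont n (i : 'I_n) : continuous (fun p : 'rV[R]_n => p ord0 i : R).
Proof. exact: coord_continuous. Qed.

Lemma fiber_coord_linear (i : 'I_4) : linear (fun e : Amb => e.2 ord0 i : R).
Proof. by move=> k a b; rewrite !mxE. Qed.

Lemma fiber_coord_cont (i : 'I_4) : continuous (fun e : Amb => e.2 ord0 i : R).
Proof.
move=> e; apply: (@continuous_comp _ _ _ snd (fun p : 'rV[R]_4 => p ord0 i)).
  exact: cvg_snd.
exact: coord_continuous.
Qed.

Let fc (i : 'I_4) := linear_fun_diff (fiber_coord_linear i) (@fiber_coord_cont i).

Lemma fiber_diff (e v : Amb) :
  [/\ differentiable cc e, differentiable cg e, differentiable ch e
    & differentiable ck e] /\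
  [/\ 'd cc e v = cc v, 'd cg e v = cg v, 'd ch e v = ch v & 'd ck e v = ck v].
Proof.
split; split.
- exact: (fc (@Ordinal 4 0 isT) e).1.
- exact: (fc (@Ordinal 4 1 isT) e).1.
- exact: (fc (@Ordinal 4 2 isT) e).1.
- exact: (fc (@Ordinal 4 3 isT) e).1.
- exact: (fc (@Ordinal 4 0 isT) e).2.
- exact: (fc (@Ordinal 4 1 isT) e).2.
- exact: (fc (@Ordinal 4 2 isT) e).2.
- exact: (fc (@Ordinal 4 3 isT) e).2.
Qed.

Lemma diff_mul (V : normedModType R) (f g : V -> R) e v :
  differentiable f e -> differentiable g e ->
  'd (fun e => f e * g e) e v = f e * 'd g e v + g e * 'd f e v.
Proof. by move=> df dg; exact: (congr1 (fun F => F v) (diffM df dg)). Qed.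

Lemma tangent_FG1E (e v : Amb) : tangent_FG1 e v <->
  cc e * ch v + ch e * cc v = cg e * ck v + ck e * cg v.
Proof.
have [[dc dg dh dk] [ec eg eh ek]] := fiber_diff e v.
have E1 := etrans (diff_mul v dc dh)
  (congr2 (fun x y => cc e * x + ch e * y) eh ec).
have E2 := etrans (diff_mul v dg dk)
  (congr2 (fun x y => cg e * x + ck e * y) ek eg).
have D := etrans (congr1 (fun F => F v)
  (diffB (differentiableM dc dh) (differentiableM dg dk)))
  (congr2 (fun x y => x - y) E1 E2).
split=> [H|/eqP]; last by rewrite -subr_eq0 => /eqP; exact: etrans D.
by apply/eqP; rewrite -subr_eq0; apply/eqP; exact: etrans (esym D) H.
Qed.

Definition codiff (E : @pde R) (F : 'rV[R]_5 -> R) (p v : 'rV[R]_5) : R :=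
  D1 E F p * x1 v + D2 E F p * x2 v + pd_y F p * theta0 p v
  + pd_z1 F p * theta1 E p v + pd_z2 F p * theta2 E p v.

Lemma diff_codiff (E : @pde R) F (p v : 'rV[R]_5) :
  differentiable F p -> 'd F p v = codiff E F p v.
Proof.
move=> dF; rewrite (jet_diff v dF) /codiff theta0E theta1E theta2E /D1 /D2.
move: (pd_x1 F p) (pd_x2 F p) (pd_y F p) (pd_z1 F p) (pd_z2 F p).
move: (x1 v) (x2 v) (y v) (z1 v) (z2 v) (z1 p) (z2 p).
by move: (rhs11 E p) (rhs12 E p) (rhs22 E p) => *; ring.
Qed.

Lemma has_dform_scale_coord (F : 'rV[R]_5 -> R) p i :
  differentiable F p ->
  let x := fun p : 'rV[R]_5 => p ord0 i : R in
  has_dform (F \*f dfun x) p (fun u v => 'd F p u * x v - 'd F p v * x u).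
Proof.
move=> dF x.
have H := has_dform_dfun p (coord_linear i) (@coord_cont _ i).
apply: has_dform_eq (has_dformZ dF H) _ => u v.
have abs (a b c d k : R) : a * b - c * d + k * 0 = a * b - c * d by ring.
exact: etrans (abs _ _ _ _ _) (congr2 (fun x y => 'd F p u * x - 'd F p v * y)
  (diff_coord i p v) (diff_coord i p u)).
Qed.

(** Replacing dz_i by theta_i in -dz1 wedge dx1 - dz2 wedge dx2 creates f12 dx1 wedge dx2 and f12
    dx2 wedge dx1, which cancel. *)
Lemma has_dform_theta0 (E : @pde R) (p : 'rV[R]_5) : has_dform theta0 p (fun u v =>
  x1 u * theta1 E p v - x1 v * theta1 E p u
  + (x2 u * theta2 E p v - x2 v * theta2 E p u)).
Proof.
have H := has_dform_dfun p (coord_linear iy) (@coord_cont _ iy).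
have d1 : differentiable (z1 : 'rV[R]_5 -> R) p by exact: differentiable_coord.
have d2 : differentiable (z2 : 'rV[R]_5 -> R) p by exact: differentiable_coord.
apply: has_dform_eq (has_dformB (has_dformB H (has_dform_scale_coord ix1 d1))
  (has_dform_scale_coord ix2 d2)) _ => u v.
have [_ _ _ e1 e2] := dfun_jet p u; have [_ _ _ e3 e4] := dfun_jet p v.
apply: etrans (congr2 (fun k l => 0 - k - l)
  (congr2 (fun a b => a * x1 v - b * x1 u) e1 e3)
  (congr2 (fun a b => a * x2 v - b * x2 u) e2 e4)) _.
rewrite !theta1E !theta2E.
move: (x1 v) (x2 v) (z1 v) (z2 v) (x1 u) (x2 u) (z1 u) (z2 u).
by move: (rhs11 E p) (rhs12 E p) (rhs22 E p) => *; ring.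
Qed.

Lemma has_dform_theta1 (E : @pde R) (p : 'rV[R]_5) : differentiable (rhs11 E) p ->
  differentiable (rhs12 E) p -> has_dform (theta1 E) p (fun u v =>
    codiff E (rhs11 E) p v * x1 u - codiff E (rhs11 E) p u * x1 v
    + (codiff E (rhs12 E) p v * x2 u - codiff E (rhs12 E) p u * x2 v)).
Proof.
move=> d1 d2; have H := has_dform_dfun p (coord_linear iz1) (@coord_cont _ iz1).
apply: has_dform_eq (has_dformB (has_dformB H (has_dform_scale_coord ix1 d1))
  (has_dform_scale_coord ix2 d2)) _ => u v.
rewrite -!(diff_codiff E _ d1) -!(diff_codiff E _ d2) /x1 /x2.
have abs (a b c d k l m n : R) :
  0 - (a * b - c * d) - (k * l - m * n) = c * d - a * b + (m * n - k * l) by ring.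
exact: abs.
Qed.

Lemma has_dform_theta2 (E : @pde R) (p : 'rV[R]_5) : differentiable (rhs12 E) p ->
  differentiable (rhs22 E) p -> has_dform (theta2 E) p (fun u v =>
    codiff E (rhs12 E) p v * x1 u - codiff E (rhs12 E) p u * x1 v
    + (codiff E (rhs22 E) p v * x2 u - codiff E (rhs22 E) p u * x2 v)).
Proof.
move=> d1 d2; have H := has_dform_dfun p (coord_linear iz2) (@coord_cont _ iz2).
apply: has_dform_eq (has_dformB (has_dformB H (has_dform_scale_coord ix1 d1))
  (has_dform_scale_coord ix2 d2)) _ => u v.
rewrite -!(diff_codiff E _ d1) -!(diff_codiff E _ d2) /x1 /x2.
have abs (a b c d k l m n : R) :
  0 - (a * b - c * d) - (k * l - m * n) = c * d - a * b + (m * n - k * l) by ring.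
exact: abs.
Qed.

End Coframe.

(** * The coframe on F_G1 *)

Section StructureEquations.
Context {R : realType}.
Notation Amb := ('rV[R]_5 * 'rV[R]_4)%type.
Variables f11 f12 f22 : 'rV[R]_5 -> R.
Let E := Pde f11 f12 f22.
Hypotheses (s11 : smooth setT f11) (s12 : smooth setT f12)
  (s22 : smooth setT f22).

Let dsm (F : 'rV[R]_5 -> R) p : smooth setT F -> differentiable F p.
Proof. by move=> sF; exact: (smooth_differentiable sF). Qed.

Let d1 F p (sF : smooth setT F) : differentiable (pd_z1 F) p :=
  dsm p (smooth_partial iz1 sF).
Let d2 F p (sF : smooth setT F) : differentiable (pd_z2 F) p :=
  dsm p (smooth_partial iz2 sF).

Lemma htheta0E (e u : Amb) : htheta0 e u = cc e * ch e * theta0 e.1 u.1.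
Proof. exact: (congr1 (fun x => cc e * ch e * x) (pullback_fst theta0 e u)). Qed.

(** The coframe forms before scaling by the fibre coordinates. The shift of theta1 cancels the dx2
    wedge theta2 term of d theta1 against the same term of d theta0; the shift of theta2 below does
    so for dx1 wedge theta1. *)
Definition theta1' (p v : 'rV[R]_5) := theta1 E p v - pd_z2 f12 p * theta0 p v.
Definition theta2' (p v : 'rV[R]_5) := theta2 E p v - pd_z1 f12 p * theta0 p v.

Lemma htheta1E (e u : Amb) : htheta1 E e u = cc e * theta1' e.1 u.1.
Proof. exact: (congr1 (fun x => cc e * x) (pullback_fst theta1' e u)). Qed.

Lemma htheta2E (e u : Amb) : htheta2 E e u = cg e * theta2' e.1 u.1.
Proof. exact: (congr1 (fun x => cg e * x) (pullback_fst theta2' e u)). Qed.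

Lemma homega1E (e u : Amb) : homega1 e u = ch e * x1 u.1.
Proof.
have [<- _ _ _ _] := dfun_jet e.1 u.1.
exact: (congr1 (fun x => ch e * x) (pullback_fst omega1 e u)).
Qed.

Lemma homega2E (e u : Amb) : homega2 e u = ck e * x2 u.1.
Proof.
have [_ <- _ _ _] := dfun_jet e.1 u.1.
exact: (congr1 (fun x => ck e * x) (pullback_fst omega2 e u)).
Qed.

Lemma dlogE (i : 'I_4) (e u : Amb) :
  dlog (fun e : Amb => e.2 ord0 i) e u = (e.2 ord0 i)^-1 * u.2 ord0 i.
Proof.
have [_ H] := linear_fun_diff (fiber_coord_linear i) (@fiber_coord_cont R i) e.
exact: (congr1 (fun x => (e.2 ord0 i)^-1 * x) (H u)).
Qed.

Definition alpha0 : form1 'rV[R]_5 :=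
  (pd_z2 (pd_z1 f12) \*f theta0
   + (fun p => pd_z1 f11 p - pd_z2 f12 p) \*f omega1 + pd_z1 f12 \*f omega2).
Definition gamma0 : form1 'rV[R]_5 :=
  ((fun p => 2 * pd_z2 f12 p - pd_z1 f11 p) \*f omega1).
Definition psi0 : form1 'rV[R]_5 :=
  ((fun p => 2 * pd_z1 f12 p - pd_z2 f22 p) \*f omega2).

Lemma halphaE (e u : Amb) : halpha E e u = (cc e)^-1 * cc u +
  (pd_z2 (pd_z1 f12) e.1 * theta0 e.1 u.1
   + (pd_z1 f11 e.1 - pd_z2 f12 e.1) * x1 u.1 + pd_z1 f12 e.1 * x2 u.1).
Proof.
have [e1 e2 _ _ _] := dfun_jet e.1 u.1.
apply: etrans (congr2 (fun x y => x + y) (dlogE (@Ordinal 4 0 isT) e u)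
  (pullback_fst alpha0 e u)) _.
exact: (congr2 (fun x y => (cc e)^-1 * cc u +
  (pd_z2 (pd_z1 f12) e.1 * theta0 e.1 u.1
   + (pd_z1 f11 e.1 - pd_z2 f12 e.1) * x + pd_z1 f12 e.1 * y)) e1 e2).
Qed.

Lemma hgammaE (e u : Amb) : hgamma E e u = (ch e)^-1 * ch u +
  (2 * pd_z2 f12 e.1 - pd_z1 f11 e.1) * x1 u.1.
Proof.
have [e1 _ _ _ _] := dfun_jet e.1 u.1.
apply: etrans (congr2 (fun x y => x + y) (dlogE (@Ordinal 4 2 isT) e u)
  (pullback_fst gamma0 e u)) _.
exact: (congr1 (fun x => (ch e)^-1 * ch u +
  (2 * pd_z2 f12 e.1 - pd_z1 f11 e.1) * x) e1).
Qed.

Lemma hpsiE (e u : Amb) : hpsi E e u = (ck e)^-1 * ck u +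
  (2 * pd_z1 f12 e.1 - pd_z2 f22 e.1) * x2 u.1.
Proof.
have [_ e1 _ _ _] := dfun_jet e.1 u.1.
apply: etrans (congr2 (fun x y => x + y) (dlogE (@Ordinal 4 3 isT) e u)
  (pullback_fst psi0 e u)) _.
exact: (congr1 (fun x => (ck e)^-1 * ck u +
  (2 * pd_z1 f12 e.1 - pd_z2 f22 e.1) * x) e1).
Qed.

Lemma dform_htheta0 (e u v : Amb) : dform htheta0 e u v =
  (cc e * ch u + ch e * cc u) * theta0 e.1 v.1
  - (cc e * ch v + ch e * cc v) * theta0 e.1 u.1
  + cc e * ch e * (x1 u.1 * theta1 E e.1 v.1 - x1 v.1 * theta1 E e.1 u.1
  + (x2 u.1 * theta2 E e.1 v.1 - x2 v.1 * theta2 E e.1 u.1)).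
Proof.
have [[dc _ dh _] [cu _ hu _]] := fiber_diff e u.
have [_ [cv _ hv _]] := fiber_diff e v.
have [_ H] := has_dformZ (differentiableM dc dh)
  (has_dform_fst (has_dform_theta0 E e.1)).
have D (a : Amb) (ca : 'd cc e a = cc a) (ha : 'd ch e a = ch a) :=
  etrans (diff_mul a dc dh) (congr2 (fun x y => cc e * x + ch e * y) ha ca).
apply: etrans (congr1 (fun F => F u v) H) _.
exact: (congr2 (fun x y => x - y + _)
  (congr2 (fun x y => x * y) (D u cu hu) (pullback_fst theta0 e v))
  (congr2 (fun x y => x * y) (D v cv hv) (pullback_fst theta0 e u))).
Qed.

Definition dtheta0 (p u v : 'rV[R]_5) :=
  x1 u * theta1 E p v - x1 v * theta1 E p u
  + (x2 u * theta2 E p v - x2 v * theta2 E p u).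

Lemma dform_htheta1 (e u v : Amb) : let p := e.1 in
  dform (htheta1 E) e u v =
  cc u * theta1' p v.1 - cc v * theta1' p u.1
  + cc e * (codiff E f11 p v.1 * x1 u.1 - codiff E f11 p u.1 * x1 v.1
    + (codiff E f12 p v.1 * x2 u.1 - codiff E f12 p u.1 * x2 v.1)
    - (codiff E (pd_z2 f12) p u.1 * theta0 p v.1
       - codiff E (pd_z2 f12) p v.1 * theta0 p u.1
       + pd_z2 f12 p * dtheta0 p u.1 v.1)).
Proof.
move=> p; have [[dc _ _ _] [cu _ _ _]] := fiber_diff e u.
have [_ [cv _ _ _]] := fiber_diff e v.
have dq : differentiable (pd_z2 f12) p by exact: d2.
have [_ H] := has_dformZ dc (has_dform_fst (has_dformB
  (has_dform_theta1 (E := E) (dsm p s11) (dsm p s12))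
  (has_dformZ dq (has_dform_theta0 E e.1)))).
rewrite -!(diff_codiff E _ dq).
apply: etrans (congr1 (fun F => F u v) H) _.
exact: (congr2 (fun x y => x - y + _)
  (congr2 (fun x y => x * y) cu (pullback_fst theta1' e v))
  (congr2 (fun x y => x * y) cv (pullback_fst theta1' e u))).
Qed.

Lemma dform_htheta2 (e u v : Amb) : let p := e.1 in
  dform (htheta2 E) e u v =
  cg u * theta2' p v.1 - cg v * theta2' p u.1
  + cg e * (codiff E f12 p v.1 * x1 u.1 - codiff E f12 p u.1 * x1 v.1
    + (codiff E f22 p v.1 * x2 u.1 - codiff E f22 p u.1 * x2 v.1)
    - (codiff E (pd_z1 f12) p u.1 * theta0 p v.1
       - codiff E (pd_z1 f12) p v.1 * theta0 p u.1
       + pd_z1 f12 p * dtheta0 p u.1 v.1)).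
Proof.
move=> p; have [[_ dc _ _] [_ cu _ _]] := fiber_diff e u.
have [_ [_ cv _ _]] := fiber_diff e v.
have dq : differentiable (pd_z1 f12) p by exact: d1.
have [_ H] := has_dformZ dc (has_dform_fst (has_dformB
  (has_dform_theta2 (E := E) (dsm p s12) (dsm p s22))
  (has_dformZ dq (has_dform_theta0 E e.1)))).
rewrite -!(diff_codiff E _ dq).
apply: etrans (congr1 (fun F => F u v) H) _.
exact: (congr2 (fun x y => x - y + _)
  (congr2 (fun x y => x * y) cu (pullback_fst theta2' e v))
  (congr2 (fun x y => x * y) cv (pullback_fst theta2' e u))).
Qed.

Let om1 p := has_dform_dfun p (coord_linear ix1) (@coord_cont R 5 ix1).
Let om2 p := has_dform_dfun p (coord_linear ix2) (@coord_cont R 5 ix2).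

Lemma dform_homega1 (e u v : Amb) :
  dform homega1 e u v = ch u * x1 v.1 - ch v * x1 u.1.
Proof.
have [[_ _ dc _] [_ _ cu _]] := fiber_diff e u.
have [_ [_ _ cv _]] := fiber_diff e v.
have [_ H] := has_dformZ dc (has_dform_fst (om1 e.1)).
have [eu _ _ _ _] := dfun_jet e.1 u.1; have [ev _ _ _ _] := dfun_jet e.1 v.1.
apply: etrans (congr1 (fun F => F u v) H) _.
apply: etrans (congr2 (fun x y => x - y + ch e * 0)
  (congr2 (fun x y => x * y) cu (etrans (pullback_fst omega1 e v) ev))
  (congr2 (fun x y => x * y) cv (etrans (pullback_fst omega1 e u) eu))) _.
have abs (a b : R) : a + b * 0 = a by ring.
exact: abs.
Qed.

Lemma dform_homega2 (e u v : Amb) :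
  dform homega2 e u v = ck u * x2 v.1 - ck v * x2 u.1.
Proof.
have [[_ _ _ dc] [_ _ _ cu]] := fiber_diff e u.
have [_ [_ _ _ cv]] := fiber_diff e v.
have [_ H] := has_dformZ dc (has_dform_fst (om2 e.1)).
have [_ eu _ _ _] := dfun_jet e.1 u.1; have [_ ev _ _ _] := dfun_jet e.1 v.1.
apply: etrans (congr1 (fun F => F u v) H) _.
apply: etrans (congr2 (fun x y => x - y + ck e * 0)
  (congr2 (fun x y => x * y) cu (etrans (pullback_fst omega2 e v) ev))
  (congr2 (fun x y => x * y) cv (etrans (pullback_fst omega2 e u) eu))) _.
have abs (a b : R) : a + b * 0 = a by ring.
exact: abs.
Qed.

Let dlog_closed (i : 'I_4) (e : Amb) : e.2 ord0 i != 0 ->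
  has_dform (dlog (fun e : Amb => e.2 ord0 i)) e (fun _ _ => 0).
Proof.
exact: (has_dform_dlog (fiber_coord_linear i) (@fiber_coord_cont R i)).
Qed.

Let diff_sub2 (F G : 'rV[R]_5 -> R) p v :
  differentiable F p -> differentiable G p ->
  differentiable (fun p => F p - G p) p /\
  'd (fun p => F p - G p) p v = codiff E F p v - codiff E G p v.
Proof.
move=> dF dG; split; first exact: (differentiableB dF dG).
rewrite -(diff_codiff E v dF) -(diff_codiff E v dG).
exact: (congr1 (fun F => F v) (diffB dF dG)).
Qed.

Let diff_sub22 (F G : 'rV[R]_5 -> R) p v :
  differentiable F p -> differentiable G p ->
  differentiable (fun p => 2 * F p - G p) p /\
  'd (fun p => 2 * F p - G p) p v = 2 * codiff E F p v - codiff E G p v.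
Proof.
move=> dF dG; have d2F : differentiable (fun p => 2 * F p) p.
  exact: (differentiableZ 2 dF).
split; first exact: (differentiableB d2F dG).
rewrite -(diff_codiff E v dF) -(diff_codiff E v dG).
apply: etrans (congr1 (fun F => F v) (diffB d2F dG)) _.
exact: (congr1 (fun x => x - 'd G p v) (congr1 (fun F => F v) (diffZ 2 dF))).
Qed.

Lemma dform_halpha (e u v : Amb) : let p := e.1 in cc e != 0 ->
  dform (halpha E) e u v =
  codiff E (pd_z2 (pd_z1 f12)) p u.1 * theta0 p v.1
  - codiff E (pd_z2 (pd_z1 f12)) p v.1 * theta0 p u.1
  + pd_z2 (pd_z1 f12) p * dtheta0 p u.1 v.1
  + ((codiff E (pd_z1 f11) p u.1 - codiff E (pd_z2 f12) p u.1) * x1 v.1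
     - (codiff E (pd_z1 f11) p v.1 - codiff E (pd_z2 f12) p v.1) * x1 u.1)
  + (codiff E (pd_z1 f12) p u.1 * x2 v.1 - codiff E (pd_z1 f12) p v.1 * x2 u.1).
Proof.
move=> p c0.
have dq : differentiable (pd_z1 f12) p by exact: d1.
have dqq : differentiable (pd_z2 (pd_z1 f12)) p.
  exact: (d2 _ (smooth_partial iz1 s12)).
have [df Df] := diff_sub2 u.1 (d1 p s11) (d2 p s12).
have [_ Dfv] := diff_sub2 v.1 (d1 p s11) (d2 p s12).
have [_ H] := has_dformD (dlog_closed (i := @Ordinal 4 0 isT) c0)
  (has_dform_fst (has_dformD (has_dformD
    (has_dformZ dqq (has_dform_theta0 E e.1))
    (has_dform_scale_coord ix1 df)) (has_dform_scale_coord ix2 dq))).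
rewrite -Df -Dfv -!(diff_codiff E _ dq) -!(diff_codiff E _ dqq).
apply: etrans (congr1 (fun F => F u v) H) _; exact: add0r.
Qed.

Lemma dform_hgamma (e u v : Amb) : let p := e.1 in ch e != 0 ->
  dform (hgamma E) e u v =
  (2 * codiff E (pd_z2 f12) p u.1 - codiff E (pd_z1 f11) p u.1) * x1 v.1
  - (2 * codiff E (pd_z2 f12) p v.1 - codiff E (pd_z1 f11) p v.1) * x1 u.1.
Proof.
move=> p c0.
have [df Df] := diff_sub22 u.1 (d2 p s12) (d1 p s11).
have [_ Dfv] := diff_sub22 v.1 (d2 p s12) (d1 p s11).
have [_ H] := has_dformD (dlog_closed (i := @Ordinal 4 2 isT) c0)
  (has_dform_fst (has_dform_scale_coord ix1 df)).
rewrite -Df -Dfv.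
apply: etrans (congr1 (fun F => F u v) H) _; exact: add0r.
Qed.

Lemma dform_hpsi (e u v : Amb) : let p := e.1 in ck e != 0 ->
  dform (hpsi E) e u v =
  (2 * codiff E (pd_z1 f12) p u.1 - codiff E (pd_z2 f22) p u.1) * x2 v.1
  - (2 * codiff E (pd_z1 f12) p v.1 - codiff E (pd_z2 f22) p v.1) * x2 u.1.
Proof.
move=> p c0.
have [df Df] := diff_sub22 u.1 (d1 p s12) (d2 p s22).
have [_ Dfv] := diff_sub22 v.1 (d1 p s12) (d2 p s22).
have [_ H] := has_dformD (dlog_closed (i := @Ordinal 4 3 isT) c0)
  (has_dform_fst (has_dform_scale_coord ix2 df)).
rewrite -Df -Dfv.
apply: etrans (congr1 (fun F => F u v) H) _; exact: add0r.
Qed.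

End StructureEquations.

(** * Structure equations *)

Section Existence.
Context {R : realType}.
Notation Amb := ('rV[R]_5 * 'rV[R]_4)%type.
Variables f11 f12 f22 : 'rV[R]_5 -> R.
Let E := Pde f11 f12 f22.
Hypotheses (s11 : smooth setT f11) (s12 : smooth setT f12)
  (s22 : smooth setT f22) (iE : integrable_pde E).

(* M_4, M_9, S_3, S_4, S_7, S_10 and S_13 are the coefficients that the same
   expansion gives. *)
Definition curvM (i : nat) (e : Amb) : R :=
  let p := e.1 in
  let c := cc e in let g := cg e in let h := ch e in let k := ck e in
  match i with
  | 1%N => - (c / (g * h)) * pd_z2 f11 p
  | 3%N => - (1 / (g * h)) * pd_z2 (pd_z2 f12) p
  | 4%N => 1 / h ^+ 2 * (pd_y f11 p + pd_z1 f11 p * pd_z2 f12 p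
           + pd_z2 f11 p * pd_z1 f12 p - D1 E (pd_z2 f12) p - pd_z2 f12 p ^+ 2)
  | 5%N => 1 / (h * k) *
      (pd_y f12 p + pd_z1 f12 p * pd_z2 f12 p - D2 E (pd_z2 f12) p)
  | 6%N => - (g / (c * k)) * pd_z1 f22 p
  | 7%N => - (1 / (c * k)) * pd_z1 (pd_z1 f12) p
  | 8%N => 1 / (h * k) *
      (pd_y f12 p + pd_z1 f12 p * pd_z2 f12 p - D1 E (pd_z1 f12) p)
  | 9%N => 1 / k ^+ 2 * (pd_y f22 p + pd_z1 f22 p * pd_z2 f12 p
           + pd_z2 f22 p * pd_z1 f12 p - D2 E (pd_z1 f12) p - pd_z1 f12 p ^+ 2)
  | _ => 0
  end.

(** In S_1 the last three terms are not those printed in the English formula: they are what remains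
    of the omega1, theta0 coefficient of d alpha after D1 of (f12)_{z1z2} is eliminated by
    [pd_z2_pd_z1_obstrA]. *)
Definition curvS (j : nat) (e : Amb) : R :=
  let p := e.1 in
  let c := cc e in let g := cg e in let h := ch e in let k := ck e in
  match j with
  | 1%N => 1 / (c * h ^+ 2) *
      (D2 E (pd_z2 (pd_z1 f11)) p
       + pd_z2 (pd_z2 f11) p * pd_z1 f22 p
       + pd_z2 (pd_z1 f11) p * pd_z2 f22 p
       + pd_z2 (pd_z1 f22) p * pd_z2 f11 p
       - pd_z1 (pd_z1 f12) p * pd_z2 f11 p
       - pd_z2 (pd_z1 f11) p * pd_z1 f12 p)
  | 2%N => 1 / (c * h * k) *
      (D2 E (pd_z2 (pd_z1 f12)) p - pd_y (pd_z1 f12) p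
       - pd_z1 (pd_z1 f12) p * pd_z2 f12 p)
  | 3%N => 1 / (c ^+ 2 * h) * pd_z1 (pd_z2 (pd_z1 f12)) p
  | 4%N => 1 / (c * g * h) * pd_z2 (pd_z2 (pd_z1 f12)) p
  | 5%N => 1 / (c * h) * (2 * pd_z2 (pd_z1 f12) p - pd_z1 (pd_z1 f11) p)
  | 6%N => 1 / (h * k) *
      (- pd_y f12 p - pd_z1 f12 p * pd_z2 f12 p
       + pd_z2 f11 p * pd_z1 f22 p + D2 E (pd_z2 f12) p)
  | 7%N => 1 / (g * h) * (pd_z2 (pd_z1 f11) p - pd_z2 (pd_z2 f12) p)
  | 8%N => 1 / (h * k) * (D2 E (pd_z1 f11) p - 2 * D2 E (pd_z2 f12) p)
  | 9%N => 1 / (c * h ^+ 2) *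
      (pd_y (pd_z1 f11) p - 2 * pd_y (pd_z2 f12) p
       + pd_z1 (pd_z1 f11) p * pd_z2 f12 p
       + pd_z2 (pd_z1 f11) p * pd_z1 f12 p
       - 2 * pd_z2 (pd_z1 f12) p * pd_z2 f12 p
       - 2 * pd_z2 (pd_z2 f12) p * pd_z1 f12 p)
  | 10%N => 1 / (g * h) * (2 * pd_z2 (pd_z2 f12) p - pd_z2 (pd_z1 f11) p)
  | 11%N => 1 / (h * k) * (2 * D1 E (pd_z1 f12) p - D1 E (pd_z2 f22) p)
  | 12%N => 1 / (c * h * k) *
      (- 2 * pd_y (pd_z1 f12) p
       - 2 * pd_z1 (pd_z1 f12) p * pd_z2 f12 p
       - 2 * pd_z2 (pd_z1 f12) p * pd_z1 f12 p
       + pd_y (pd_z2 f22) p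
       + pd_z2 (pd_z1 f22) p * pd_z2 f12 p
       + pd_z2 (pd_z2 f22) p * pd_z1 f12 p)
  | 13%N => 1 / (c * k) * (2 * pd_z1 (pd_z1 f12) p - pd_z2 (pd_z1 f22) p)
  | 14%N => 1 / (g * k) * (2 * pd_z2 (pd_z1 f12) p - pd_z2 (pd_z2 f22) p)
  | _ => 0
  end.

(** * The structure equations on tangent vectors at one point of F_G1 *)

Section AtPoint.
Variables (e : Amb) (Fe : FG1 e).
Let c0 : cc e != 0. Proof. by case: Fe. Qed.
Let g0 : cg e != 0. Proof. by case: Fe. Qed.
Let h0 : ch e != 0. Proof. by case: Fe. Qed.
Let k0 : ck e != 0. Proof. by case: Fe. Qed.
Let gE : cg e = cc e * ch e / ck e.
Proof. by case: Fe => _ _ _ _ ->; rewrite mulfK. Qed.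
Variables (u v : Amb) (Tu : tangent_FG1 e u) (Tv : tangent_FG1 e v).

(** The linearised relation ch = gk solved for the g-component, which occurs only in d theta2. *)
Let ugE (w : Amb) : tangent_FG1 e w ->
  cg w = (cc e * ch w + ch e * cc w - cc e * ch e / ck e * ck w) / ck e.
Proof.
move=> Tw; apply: (mulIf k0); rewrite divfK// ((tangent_FG1E e w).1 Tw) -gE.
by rewrite mulrC addrAC subrr add0r.
Qed.

Let swap (F : 'rV[R]_5 -> R) : smooth setT F -> pd_z1 (pd_z2 F) = pd_z2 (pd_z1 F).
Proof. exact: partial_comm. Qed.

(** On the base, alpha + gamma reduces to (f12)_{z2} omega1 + (f12)_{z1} omega2 modulo theta0, which
    offsets the shifts in [theta1'] and [theta2']; ch = gk matches the factors of the omega2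
    term. *)
Lemma eq_htheta0 : dform htheta0 e u v =
  ((halpha E + hgamma E) \wedge htheta0 + homega1 \wedge htheta1 E
   + homega2 \wedge htheta2 E) e u v.
Proof.
rewrite (dform_htheta0 f11 f12 f22).
transitivity (
  (halpha E e u + hgamma E e u) * htheta0 e v
  - (halpha E e v + hgamma E e v) * htheta0 e u
  + (homega1 e u * htheta1 E e v - homega1 e v * htheta1 E e u)
  + (homega2 e u * htheta2 E e v - homega2 e v * htheta2 E e u)); last by [].
rewrite !halphaE !hgammaE !htheta0E !homega1E !homega2E !htheta1E !htheta2E.
rewrite /theta1' /theta2' gE.
generalize (theta1 E e.1 v.1) (theta2 E e.1 v.1) (theta0 e.1 v.1).
generalize (theta1 E e.1 u.1) (theta2 E e.1 u.1) (theta0 e.1 u.1).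
move: c0 g0 h0 k0; move: (cc e) (cg e) (ch e) (ck e) => c g h k c00 g00 h00 k00.
by move=> *; field; rewrite c00 h00 k00.
Qed.

(** The coefficient of dx1 wedge dx2 on the left is c times A, and [D2_f11] makes it vanish. *)
Lemma eq_htheta1 : dform (htheta1 E) e u v =
  (halpha E \wedge htheta1 E + curvM 1%N \*f htheta2 E \wedge homega1
   + curvM 3%N \*f htheta2 E \wedge htheta0
   + curvM 4%N \*f homega1 \wedge htheta0
   + curvM 5%N \*f homega2 \wedge htheta0) e u v.
Proof.
rewrite (dform_htheta1 f22 s11 s12).
transitivity (
  halpha E e u * htheta1 E e v - halpha E e v * htheta1 E e u
  + curvM 1%N e * (htheta2 E e u * homega1 e v - htheta2 E e v * homega1 e u)
  + curvM 3%N e * (htheta2 E e u * htheta0 e v - htheta2 E e v * htheta0 e u)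
  + curvM 4%N e * (homega1 e u * htheta0 e v - homega1 e v * htheta0 e u)
  + curvM 5%N e * (homega2 e u * htheta0 e v - homega2 e v * htheta0 e u));
  last by [].
rewrite !halphaE !htheta0E !homega1E !homega2E !htheta1E !htheta2E.
rewrite /curvM /codiff /dtheta0 /theta1' /theta2' gE (D2_f11 iE) (swap s12) -!/E.
generalize (theta1 E e.1 v.1) (theta2 E e.1 v.1) (theta0 e.1 v.1) (x1 v.1) (x2 v.1).
generalize (theta1 E e.1 u.1) (theta2 E e.1 u.1) (theta0 e.1 u.1) (x1 u.1) (x2 u.1).
generalize (D1 E f11 e.1) (D1 E f12 e.1) (D2 E f12 e.1) (D1 E (pd_z2 f12) e.1)
  (D2 E (pd_z2 f12) e.1) (pd_y f11 e.1) (pd_z1 f11 e.1) (pd_z2 f11 e.1)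
  (pd_z2 (pd_z2 f12) e.1) (pd_z2 (pd_z1 f12) e.1) (pd_y (pd_z2 f12) e.1)
  (pd_y f12 e.1) (pd_z1 f12 e.1) (pd_z2 f12 e.1) (cc u) (cc v).
move: c0 g0 h0 k0; move: (cc e) (cg e) (ch e) (ck e) => c g h k c00 g00 h00 k00.
by move=> *; field; rewrite c00 h00 k00.
Qed.

(** Here B = 0 removes the dx1 wedge dx2 term, and tangency, through [ugE], identifies dg/g with the
    fibre part of alpha + gamma - psi. *)
Lemma eq_htheta2 : dform (htheta2 E) e u v =
  ((halpha E + hgamma E - hpsi E) \wedge htheta2 E
   + curvM 6%N \*f htheta1 E \wedge homega2
   + curvM 7%N \*f htheta1 E \wedge htheta0
   + curvM 8%N \*f homega1 \wedge htheta0
   + curvM 9%N \*f homega2 \wedge htheta0) e u v.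
Proof.
rewrite (dform_htheta2 f11 s12 s22).
transitivity (
  (halpha E e u + hgamma E e u - hpsi E e u) * htheta2 E e v
  - (halpha E e v + hgamma E e v - hpsi E e v) * htheta2 E e u
  + curvM 6%N e * (htheta1 E e u * homega2 e v - htheta1 E e v * homega2 e u)
  + curvM 7%N e * (htheta1 E e u * htheta0 e v - htheta1 E e v * htheta0 e u)
  + curvM 8%N e * (homega1 e u * htheta0 e v - homega1 e v * htheta0 e u)
  + curvM 9%N e * (homega2 e u * htheta0 e v - homega2 e v * htheta0 e u));
  last by [].
rewrite !halphaE !hgammaE !hpsiE !htheta0E !homega1E !homega2E !htheta1E !htheta2E.
rewrite /curvM /codiff /dtheta0 /theta1' /theta2' gE (D2_f12 iE) -!/E.
rewrite (ugE Tu) (ugE Tv).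
generalize (theta1 E e.1 v.1) (theta2 E e.1 v.1) (theta0 e.1 v.1) (x1 v.1) (x2 v.1).
generalize (theta1 E e.1 u.1) (theta2 E e.1 u.1) (theta0 e.1 u.1) (x1 u.1) (x2 u.1).
generalize (D1 E f12 e.1) (D1 E f22 e.1) (D2 E f22 e.1) (D1 E (pd_z1 f12) e.1)
  (D2 E (pd_z1 f12) e.1) (pd_y f22 e.1) (pd_z1 f22 e.1) (pd_z2 f22 e.1)
  (pd_z1 (pd_z1 f12) e.1) (pd_z2 (pd_z1 f12) e.1) (pd_y (pd_z1 f12) e.1)
  (pd_y f12 e.1) (pd_z1 f12 e.1) (pd_z2 f12 e.1) (pd_z1 f11 e.1)
  (cc u) (cc v) (ch u) (ch v) (ck u) (ck v).
move: c0 g0 h0 k0; move: (cc e) (cg e) (ch e) (ck e) => c g h k c00 g00 h00 k00.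
by move=> *; field; rewrite c00 h00 k00.
Qed.

Lemma eq_homega1 : dform homega1 e u v = (hgamma E \wedge homega1) e u v.
Proof.
rewrite dform_homega1.
transitivity (hgamma E e u * homega1 e v - hgamma E e v * homega1 e u); last by [].
rewrite !hgammaE !homega1E.
move: h0; move: (ch e) (pd_z1 f11 e.1) (pd_z2 f12 e.1) (ch u) (ch v) => h * .
by field.
Qed.

Lemma eq_homega2 : dform homega2 e u v = (hpsi E \wedge homega2) e u v.
Proof.
rewrite dform_homega2.
transitivity (hpsi E e u * homega2 e v - hpsi E e v * homega2 e u); last by [].
rewrite !hpsiE !homega2E.
move: k0; move: (ck e) (pd_z1 f12 e.1) (pd_z2 f22 e.1) (ck u) (ck v) => h * .
by field.
Qed.

Lemma eq_halpha : dform (halpha E) e u v =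
  (curvS 1%N \*f homega1 \wedge htheta0 + curvS 2%N \*f homega2 \wedge htheta0
   + curvS 3%N \*f htheta1 E \wedge htheta0
   + curvS 4%N \*f htheta2 E \wedge htheta0
   + curvS 5%N \*f homega1 \wedge htheta1 E
   + curvS 6%N \*f homega1 \wedge homega2
   + curvS 7%N \*f htheta2 E \wedge homega1
   - curvM 7%N \*f htheta1 E \wedge homega2) e u v.
Proof.
rewrite (dform_halpha f22 s11 s12 _ _ c0).
transitivity (
  curvS 1%N e * (homega1 e u * htheta0 e v - homega1 e v * htheta0 e u)
  + curvS 2%N e * (homega2 e u * htheta0 e v - homega2 e v * htheta0 e u)
  + curvS 3%N e * (htheta1 E e u * htheta0 e v - htheta1 E e v * htheta0 e u)
  + curvS 4%N e * (htheta2 E e u * htheta0 e v - htheta2 E e v * htheta0 e u)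
  + curvS 5%N e * (homega1 e u * htheta1 E e v - homega1 e v * htheta1 E e u)
  + curvS 6%N e * (homega1 e u * homega2 e v - homega1 e v * homega2 e u)
  + curvS 7%N e * (htheta2 E e u * homega1 e v - htheta2 E e v * homega1 e u)
  - curvM 7%N e * (htheta1 E e u * homega2 e v - htheta1 E e v * homega2 e u));
  last by [].
rewrite !htheta0E !homega1E !homega2E !htheta1E !htheta2E.
rewrite /curvM /curvS /codiff /dtheta0 /theta1' /theta2' gE (swap s12) -!/E.
have := pd_z1_obstrA s11 s12 s22 iE e.1.
have := pd_z2_pd_z1_obstrA s11 s12 s22 iE e.1.
rewrite -!/E.
generalize (theta1 E e.1 v.1) (theta2 E e.1 v.1) (theta0 e.1 v.1) (x1 v.1) (x2 v.1).
generalize (theta1 E e.1 u.1) (theta2 E e.1 u.1) (theta0 e.1 u.1) (x1 u.1) (x2 u.1).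
generalize (D1 E (pd_z2 (pd_z1 f12)) e.1) (D2 E (pd_z2 (pd_z1 f12)) e.1)
  (pd_y (pd_z2 (pd_z1 f12)) e.1) (pd_z1 (pd_z2 (pd_z1 f12)) e.1)
  (pd_z2 (pd_z2 (pd_z1 f12)) e.1) (D2 E (pd_z2 (pd_z1 f11)) e.1).
generalize (D1 E (pd_z1 f11) e.1) (D2 E (pd_z1 f11) e.1) (pd_y (pd_z1 f11) e.1)
  (pd_z1 (pd_z1 f11) e.1) (pd_z2 (pd_z1 f11) e.1) (pd_z2 (pd_z2 f11) e.1).
generalize (D1 E (pd_z2 f12) e.1) (D2 E (pd_z2 f12) e.1) (pd_y (pd_z2 f12) e.1)
  (pd_z2 (pd_z1 f12) e.1) (pd_z2 (pd_z2 f12) e.1).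
generalize (D1 E (pd_z1 f12) e.1) (D2 E (pd_z1 f12) e.1) (pd_y (pd_z1 f12) e.1)
  (pd_z1 (pd_z1 f12) e.1) (pd_z2 (pd_z1 f22) e.1).
generalize (pd_y f12 e.1) (pd_z1 f12 e.1) (pd_z2 f12 e.1) (pd_z1 f22 e.1) (pd_z2 f22 e.1)
  (pd_z2 f11 e.1).
move: c0 g0 h0 k0; move: (cc e) (cg e) (ch e) (ck e) => c g h k c00 g00 h00 k00.
move=> qy q1 q2 r1 r2 f2 D1q1 D2q1 qy1 q11 r12 D1q2 D2q2 qy2 q12 q22.
move=> D1f1 D2f1 fy1 f11' f12' f22' D1q12 D2q12 qy12 q112 q122 D2f12.
move=> t1u t2u t0u a1u a2u t1v t2v t0v a1v a2v R1 R2.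
(* Both consequences of A = 0 are solved for their D1-term; substituting them leaves an identity of
   rational functions in independent variables. *)
have {}R2 : D1q1 = D2f1 + r1 * f2 - qy - q1 * q2 by rewrite R2; ring.
have {}R1 : D1q12 = D2f12 + fy1 + q2 * f11' + r2 * f12' + r12 * f2 + r1 * f22'
  - (f2 * q11 + 2 * (q2 * q12) + qy2 + q1 * q22) by rewrite R1; ring.
rewrite R1 R2.
by field; rewrite c00 h00 k00.
Qed.

Lemma eq_hgamma : dform (hgamma E) e u v =
  (curvS 8%N \*f homega1 \wedge homega2 + curvS 9%N \*f homega1 \wedge htheta0
   + curvS 5%N \*f htheta1 E \wedge homega1
   + curvS 10%N \*f htheta2 E \wedge homega1) e u v.
Proof.
rewrite (dform_hgamma f22 s11 s12 _ _ h0).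
transitivity (
  curvS 8%N e * (homega1 e u * homega2 e v - homega1 e v * homega2 e u)
  + curvS 9%N e * (homega1 e u * htheta0 e v - homega1 e v * htheta0 e u)
  + curvS 5%N e * (htheta1 E e u * homega1 e v - htheta1 E e v * homega1 e u)
  + curvS 10%N e * (htheta2 E e u * homega1 e v - htheta2 E e v * homega1 e u));
  last by [].
rewrite !htheta0E !homega1E !homega2E !htheta1E !htheta2E.
rewrite /curvS /codiff /theta1' /theta2' gE (swap s12) -!/E.
generalize (theta1 E e.1 v.1) (theta2 E e.1 v.1) (theta0 e.1 v.1) (x1 v.1) (x2 v.1).
generalize (theta1 E e.1 u.1) (theta2 E e.1 u.1) (theta0 e.1 u.1) (x1 u.1) (x2 u.1).
generalize (D1 E (pd_z1 f11) e.1) (D2 E (pd_z1 f11) e.1) (pd_y (pd_z1 f11) e.1)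
  (pd_z1 (pd_z1 f11) e.1) (pd_z2 (pd_z1 f11) e.1).
generalize (D1 E (pd_z2 f12) e.1) (D2 E (pd_z2 f12) e.1) (pd_y (pd_z2 f12) e.1)
  (pd_z2 (pd_z1 f12) e.1) (pd_z2 (pd_z2 f12) e.1) (pd_z1 f12 e.1) (pd_z2 f12 e.1).
move: c0 g0 h0 k0; move: (cc e) (cg e) (ch e) (ck e) => c g h k c00 g00 h00 k00.
by move=> *; field; rewrite c00 h00 k00.
Qed.

Lemma eq_hpsi : dform (hpsi E) e u v =
  (curvS 11%N \*f homega1 \wedge homega2 + curvS 12%N \*f homega2 \wedge htheta0
   + curvS 13%N \*f htheta1 E \wedge homega2
   + curvS 14%N \*f htheta2 E \wedge homega2) e u v.
Proof.
rewrite (dform_hpsi f11 s12 s22 _ _ k0).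
transitivity (
  curvS 11%N e * (homega1 e u * homega2 e v - homega1 e v * homega2 e u)
  + curvS 12%N e * (homega2 e u * htheta0 e v - homega2 e v * htheta0 e u)
  + curvS 13%N e * (htheta1 E e u * homega2 e v - htheta1 E e v * homega2 e u)
  + curvS 14%N e * (htheta2 E e u * homega2 e v - htheta2 E e v * homega2 e u));
  last by [].
rewrite !htheta0E !homega1E !homega2E !htheta1E !htheta2E.
rewrite /curvS /codiff /theta1' /theta2' gE (swap s22) -!/E.
generalize (theta1 E e.1 v.1) (theta2 E e.1 v.1) (theta0 e.1 v.1) (x1 v.1) (x2 v.1).
generalize (theta1 E e.1 u.1) (theta2 E e.1 u.1) (theta0 e.1 u.1) (x1 u.1) (x2 u.1).
generalize (D1 E (pd_z1 f12) e.1) (D2 E (pd_z1 f12) e.1) (pd_y (pd_z1 f12) e.1)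
  (pd_z1 (pd_z1 f12) e.1) (pd_z2 (pd_z1 f12) e.1).
generalize (D1 E (pd_z2 f22) e.1) (D2 E (pd_z2 f22) e.1) (pd_y (pd_z2 f22) e.1)
  (pd_z2 (pd_z1 f22) e.1) (pd_z2 (pd_z2 f22) e.1) (pd_z1 f12 e.1) (pd_z2 f12 e.1).
move: c0 g0 h0 k0; move: (cc e) (cg e) (ch e) (ck e) => c g h k c00 g00 h00 k00.
by move=> *; field; rewrite c00 h00 k00.
Qed.

End AtPoint.

Lemma curvature_structure_equations : structure_equations E curvM curvS.
Proof.
split; [ | | |split|split] => e Fe u v Tu Tv.
- exact: eq_htheta0.
- exact: eq_htheta1.
- exact: eq_htheta2.
- exact: eq_homega1.
- exact: eq_homega2.
- exact: eq_halpha.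
- exact: eq_hgamma.
- exact: eq_hpsi.
Qed.

End Existence.

(** * Uniqueness of the curvatures *)

Section Uniqueness.
Context {R : realType}.
Notation Amb := ('rV[R]_5 * 'rV[R]_4)%type.

Section FormEval.
Context {V : normedModType R}.
Implicit Types (a b : form1 V) (A B : form2 V) (e u v : V).

Lemma form2D A B e u v : (A + B) e u v = A e u v + B e u v. Proof. by []. Qed.
Lemma form2Z (m : V -> R) A e u v : (m \*f A) e u v = m e * A e u v.
Proof. by []. Qed.
Lemma wedgeE a b e u v : (a \wedge b) e u v = a e u * b e v - a e v * b e u.
Proof. by []. Qed.

End FormEval.

Variables f11 f12 f22 : 'rV[R]_5 -> R.
Let E := Pde f11 f12 f22.

(** The system is triangular: dx_i first, then theta0, then theta1 and theta2. The fibre component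
    can be taken zero, which makes the vector tangent at once. *)
Lemma coframe_dual (e : Amb) (t0 t1 t2 a1 a2 : R) : FG1 e ->
  exists u : Amb, tangent_FG1 e u /\
    [/\ htheta0 e u = t0, htheta1 E e u = t1, htheta2 E e u = t2,
        homega1 e u = a1 & homega2 e u = a2].
Proof.
case=> c0 g0 h0 k0 _; pose p := e.1.
pose b1 := a1 / ch e; pose b2 := a2 / ck e; pose s0 := t0 / (cc e * ch e).
pose s1 := t1 / cc e + pd_z2 f12 p * s0; pose s2 := t2 / cg e + pd_z1 f12 p * s0.
pose w : 'rV[R]_5 := \row_(i < 5) [:: b1; b2; s0 + z1 p * b1 + z2 p * b2;
  s1 + f11 p * b1 + f12 p * b2; s2 + f12 p * b1 + f22 p * b2]`_i.
have [w1 w2] : x1 w = b1 /\ x2 w = b2 by rewrite /x1 /x2 !mxE.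
have w3 : y w = s0 + z1 p * b1 + z2 p * b2 by rewrite /y !mxE.
have w4 : z1 w = s1 + f11 p * b1 + f12 p * b2 by rewrite {1}/z1 !mxE.
have w5 : z2 w = s2 + f12 p * b1 + f22 p * b2 by rewrite {1}/z2 !mxE.
have e0 : theta0 p w = s0.
  by rewrite theta0E w1 w2 w3; generalize (z1 p) (z2 p) s0 b1 b2; move=> *; ring.
have e1 : theta1 E p w = s1.
  by rewrite theta1E w1 w2 w4 /=; generalize (f11 p) (f12 p) s1 b1 b2; move=> *; ring.
have e2 : theta2 E p w = s2.
  by rewrite theta2E w1 w2 w5 /=; generalize (f22 p) (f12 p) s2 b1 b2; move=> *; ring.
exists (w, 0); split.
  by apply/tangent_FG1E; rewrite /cc /ch /cg /ck /= !mxE !mulr0.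
rewrite htheta0E htheta1E htheta2E homega1E homega2E /theta1' /theta2' /=.
rewrite -/p -/E e0 e1 e2 w1 w2.
have M (x t : R) : x != 0 -> x * (t / x) = t by move=> x0; rewrite mulrC divfK.
have M' (x t s : R) : x != 0 -> x * (t / x + s - s) = t.
  by move=> x0; rewrite addrK M.
by split; [exact: M (mulf_neq0 c0 h0)|exact: M'|exact: M'|exact: M|exact: M].
Qed.

(** A pair of dual vectors isolates the coefficient of one wedge product. The values of alpha, gamma
    and psi on these vectors are left open, but they occur only multiplied by theta1 or theta2,
    which is zero on both vectors of the chosen pair. *)
Lemma curvatures_unique (M S M' S' : nat -> Amb -> R) (e : Amb) :
  structure_equations E M S -> structure_equations E M' S' -> FG1 e ->
  (forall i, (i \in [:: 1; 3; 5; 6; 7; 8])%N -> M i e = M' i e) /\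
  (forall j, (j \in [:: 1; 2; 5; 6; 8; 9; 11; 12; 14])%N -> S j e = S' j e).
Proof.
move=> [_ H1 H2 _ [Ha Hg Hp]] [_ K1 K2 _ [Ka Kg Kp]] Fe.
have dual t0 t1 t2 a1 a2 := coframe_dual t0 t1 t2 a1 a2 Fe.
have [t [Tt [t0 t1 t2 t3 t4]]] := dual 1 0 0 0 0.
have [u [Tu [u0 u1 u2 u3 u4]]] := dual 0 1 0 0 0.
have [v [Tv [v0 v1 v2 v3 v4]]] := dual 0 0 1 0 0.
have [a [Ta [a0 a1 a2 a3 a4]]] := dual 0 0 0 1 0.
have [b [Tb [b0 b1 b2 b3 b4]]] := dual 0 0 0 0 1.
have evA (D N : nat -> Amb -> R) (w w' : Amb) :
  (D 1%N \*f homega1 \wedge htheta0 + D 2%N \*f homega2 \wedge htheta0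
   + D 3%N \*f htheta1 E \wedge htheta0 + D 4%N \*f htheta2 E \wedge htheta0
   + D 5%N \*f homega1 \wedge htheta1 E + D 6%N \*f homega1 \wedge homega2
   + D 7%N \*f htheta2 E \wedge homega1
   - N 7%N \*f htheta1 E \wedge homega2) e w w' =
  D 1%N e * (homega1 e w * htheta0 e w' - homega1 e w' * htheta0 e w)
  + D 2%N e * (homega2 e w * htheta0 e w' - homega2 e w' * htheta0 e w)
  + D 3%N e * (htheta1 E e w * htheta0 e w' - htheta1 E e w' * htheta0 e w)
  + D 4%N e * (htheta2 E e w * htheta0 e w' - htheta2 E e w' * htheta0 e w)
  + D 5%N e * (homega1 e w * htheta1 E e w' - homega1 e w' * htheta1 E e w)
  + D 6%N e * (homega1 e w * homega2 e w' - homega1 e w' * homega2 e w)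
  + D 7%N e * (htheta2 E e w * homega1 e w' - htheta2 E e w' * homega1 e w)
  - N 7%N e * (htheta1 E e w * homega2 e w' - htheta1 E e w' * homega2 e w).
  by [].
have val := (t0, t1, t2, t3, t4, (u0, u1, u2, u3, u4), (v0, v1, v2, v3, v4),
  (a0, a1, a2, a3, a4), (b0, b1, b2, b3, b4)).
have simp := (@mul0r R, @mulr0 R, @mulr1 R, @subrr R, @subr0 R, @addr0 R, @add0r R,
  @oppr0 R).
have Hd w w' Tw Tw' := etrans (esym (Ha e Fe w w' Tw Tw')) (Ka e Fe w w' Tw Tw').
have {}Hd w w' : tangent_FG1 e w -> tangent_FG1 e w' -> _ =
    _ := fun Tw Tw' => etrans (esym (evA S M w w'))
      (etrans (Hd w w' Tw Tw') (evA S' M' w w')).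
split=> i; rewrite !inE.
- case/or4P => [/eqP->|/eqP->|/eqP->|/or3P[/eqP->|/eqP->|/eqP->]].
  + have := etrans (esym (H1 e Fe v a Tv Ta)) (K1 e Fe v a Tv Ta).
    by rewrite !(form2D, form2Z, wedgeE) !val !simp.
  + have := etrans (esym (H1 e Fe v t Tv Tt)) (K1 e Fe v t Tv Tt).
    by rewrite !(form2D, form2Z, wedgeE) !val !simp.
  + have := etrans (esym (H1 e Fe b t Tb Tt)) (K1 e Fe b t Tb Tt).
    by rewrite !(form2D, form2Z, wedgeE) !val !simp.
  + have := etrans (esym (H2 e Fe u b Tu Tb)) (K2 e Fe u b Tu Tb).
    by rewrite !(form2D, form2Z, wedgeE) !val !simp.
  + have := etrans (esym (H2 e Fe u t Tu Tt)) (K2 e Fe u t Tu Tt).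
    by rewrite !(form2D, form2Z, wedgeE) !val !simp.
  + have := etrans (esym (H2 e Fe a t Ta Tt)) (K2 e Fe a t Ta Tt).
    by rewrite !(form2D, form2Z, wedgeE) !val !simp.
- case/or4P => [/eqP->|/eqP->|/eqP->|].
  + by have := Hd a t Ta Tt; rewrite !val !simp.
  + by have := Hd b t Tb Tt; rewrite !val !simp.
  + by have := Hd a u Ta Tu; rewrite !val !simp.
  case/or4P => [/eqP->|/eqP->|/eqP->|/or3P[/eqP->|/eqP->|/eqP->]].
  + by have := Hd a b Ta Tb; rewrite !val !simp.
  + have := etrans (esym (Hg e Fe a b Ta Tb)) (Kg e Fe a b Ta Tb).
    by rewrite !(form2D, form2Z, wedgeE) !val !simp.
  + have := etrans (esym (Hg e Fe a t Ta Tt)) (Kg e Fe a t Ta Tt).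
    by rewrite !(form2D, form2Z, wedgeE) !val !simp.
  + have := etrans (esym (Hp e Fe a b Ta Tb)) (Kp e Fe a b Ta Tb).
    by rewrite !(form2D, form2Z, wedgeE) !val !simp.
  + have := etrans (esym (Hp e Fe b t Tb Tt)) (Kp e Fe b t Tb Tt).
    by rewrite !(form2D, form2Z, wedgeE) !val !simp.
  + have := etrans (esym (Hp e Fe v b Tv Tb)) (Kp e Fe v b Tv Tb).
    by rewrite !(form2D, form2Z, wedgeE) !val !simp.
Qed.

End Uniqueness.

(** The curvatures are quantified as any solution of the structure equations, and the existence
    clause keeps the formulas from being vacuous. *)
Theorem theorem1 (R : realType) :
  (forall f11 f12 f22 : 'rV[R]_5 -> R,
     let E := Pde f11 f12 f22 in
     smooth_pde E -> integrable_pde E ->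
     (exists M S : nat -> 'rV[R]_5 * 'rV[R]_4 -> R, structure_equations E M S)
     /\
     (forall M S : nat -> 'rV[R]_5 * 'rV[R]_4 -> R, structure_equations E M S ->
      forall e, FG1 e ->
      let p := e.1 in
      let c := cc e in let g := cg e in let h := ch e in let k := ck e in
      [/\ [/\ M 1%N e = - (c / (g * h)) * pd_z2 f11 p,
              M 3%N e = - (1 / (g * h)) * pd_z2 (pd_z2 f12) p,
              M 5%N e = 1 / (h * k) *
                (pd_y f12 p + pd_z1 f12 p * pd_z2 f12 p - D2 E (pd_z2 f12) p),
              M 6%N e = - (g / (c * k)) * pd_z1 f22 p &
              M 7%N e = - (1 / (c * k)) * pd_z1 (pd_z1 f12) p],
          M 8%N e = 1 / (h * k) *
            (pd_y f12 p + pd_z1 f12 p * pd_z2 f12 p - D1 E (pd_z1 f12) p),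
          [/\ S 1%N e = 1 / (c * h ^+ 2) *
                (D2 E (pd_z2 (pd_z1 f11)) p
                 + pd_z2 (pd_z2 f11) p * pd_z1 f22 p
                 + pd_z2 (pd_z1 f11) p * pd_z2 f22 p
                 + pd_z2 (pd_z1 f22) p * pd_z2 f11 p
                 - pd_z1 (pd_z1 f12) p * pd_z2 f11 p
                 - pd_z2 (pd_z1 f11) p * pd_z1 f12 p),
              S 2%N e = 1 / (c * h * k) *
                (D2 E (pd_z2 (pd_z1 f12)) p - pd_y (pd_z1 f12) p
                 - pd_z1 (pd_z1 f12) p * pd_z2 f12 p),
              S 5%N e = 1 / (c * h) *
                (2 * pd_z2 (pd_z1 f12) p - pd_z1 (pd_z1 f11) p) &
              S 6%N e = 1 / (h * k) *
                (- pd_y f12 p - pd_z1 f12 p * pd_z2 f12 p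
                 + pd_z2 f11 p * pd_z1 f22 p + D2 E (pd_z2 f12) p)],
          [/\ S 8%N e = 1 / (h * k) *
                (D2 E (pd_z1 f11) p - 2 * D2 E (pd_z2 f12) p) &
              S 9%N e = 1 / (c * h ^+ 2) *
                (pd_y (pd_z1 f11) p - 2 * pd_y (pd_z2 f12) p
                 + pd_z1 (pd_z1 f11) p * pd_z2 f12 p
                 + pd_z2 (pd_z1 f11) p * pd_z1 f12 p
                 - 2 * pd_z2 (pd_z1 f12) p * pd_z2 f12 p
                 - 2 * pd_z2 (pd_z2 f12) p * pd_z1 f12 p)] &
          [/\ S 11%N e = 1 / (h * k) *
                (2 * D1 E (pd_z1 f12) p - D1 E (pd_z2 f22) p),
              S 12%N e = 1 / (c * h * k) *
                (- 2 * pd_y (pd_z1 f12) p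
                 - 2 * pd_z1 (pd_z1 f12) p * pd_z2 f12 p
                 - 2 * pd_z2 (pd_z1 f12) p * pd_z1 f12 p
                 + pd_y (pd_z2 f22) p
                 + pd_z2 (pd_z1 f22) p * pd_z2 f12 p
                 + pd_z2 (pd_z2 f22) p * pd_z1 f12 p) &
              S 14%N e = 1 / (g * k) *
                (2 * pd_z2 (pd_z1 f12) p - pd_z2 (pd_z2 f22) p)]]))
  /\
  (forall P Q T : 'rV[R]_3 -> R,
     smooth [set: 'rV[R]_3] P -> smooth [set: 'rV[R]_3] Q ->
     smooth [set: 'rV[R]_3] T ->
     let E := Pde (P \o J0_of_J1) (Q \o J0_of_J1) (T \o J0_of_J1) in
     locally_flat_under_scale E <-> integrable_pde E).

Proof.
split=> [f11 f12 f22 E [s11 s12 s22] iE|P Q T sP sQ sT E].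
  have HE := curvature_structure_equations s11 s12 s22 iE.
  split=> [|M S HMS e Fe p c g h k]; first by
    exists (curvM f11 f12 f22), (curvS f11 f12 f22).
  have [uM uS] := curvatures_unique HMS HE Fe.
  by split; [split; rewrite uM|rewrite uM|split; rewrite uS|split; rewrite uS
    |split; rewrite uS].
split=> [|iE]; last exact: flat_of_integrable.
apply: integrable_of_flat => p.
by split; apply: differentiable_J0_of_J1; [exact: (smooth_differentiable sP)
  |exact: (smooth_differentiable sQ)|exact: (smooth_differentiable sT)].
Qed.
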